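(* The symbolic dynamical system $\mathcal X_{\mathcal P_0,R_0}$ and the minimal subshift $X_0\subset\Omega_0$ of the Jeandel-Rao Wang shift have the same substitutive structure in the sense that the following equalities hold: $$\beta_0=\omega_0\omega_1\omega_2\omega_3,\quad \beta_1\beta_2=\jmath\,\eta\,\omega_6,\quad \beta_3=\omega_7,\quad\beta_4=\omega_8,\quad\beta_5=\omega_9,\quad\beta_6=\omega_{10},\quad\beta_7=\omega_{11},\quad\zeta=\rho,\quad \beta_8\beta_9\tau=\rho\,\omega_{\mathcal U}\,\rho^{-1},$$ where $\beta_0,\dots,\beta_9,\tau,\zeta$ are the maps obtained from $\mathcal P_0,R_0$ by the induction procedure described in the context, and the maps $\omega_0\omega_1\omega_2\omega_3$, $\jmath\,\eta\,\omega_6$, $\omega_7,\dots,\omega_{11}$, $\rho$, $\omega_{\mathcal U}$ giving the substitutive structure of $X_0$ are the explicit maps listed in the context.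
   Context: **Words and morphisms.** A $2$-dimensional word of shape $(n_1,n_2)$ over $\mathcal A$ is a map $\{0,\dots,n_1-1\}\times\{0,\dots,n_2-1\}\to\mathcal A$. Below, $[a,b]$ is the row (shape $(2,1)$) read left to right, $\langle a_1,\dots,a_n\rangle$ is the column (shape $(1,n)$) read from bottom to top, and $\begin{pmatrix}c&d\\ a&b\end{pmatrix}$ is the $2\times2$ word with bottom row $a,b$ and top row $c,d$. A $2$-dimensional morphism is determined by images of letters and satisfies $\omega(u\odot^iv)=\omega(u)\odot^i\omega(v)$ whenever the concatenation $u\odot^iv$ in direction $\boldsymbol e_i$ lies in its domain language; it extends to configurations in $\mathcal A^{\mathbb Z^2}$ with the lower-left corner of the image of $x_{\boldsymbol 0}$ at the origin. Products denote composition. For $M=\begin{pmatrix}1&1\\0&1\end{pmatrix}$ let $\theta_M(w)(\boldsymbol n)=w(M^{-1}\boldsymbol n)$. **Partitions.** A topological partition is a finite collection of disjoint open sets whose closures cover. Let $\varphi=\frac{1+\sqrt5}2$, $s=\varphi^{-1}$, $t=\varphi^{-2}$, $u=\varphi^{-3}$, $\Gamma_0=\langle(\varphi,0),(1,\varphi+3)\rangle_{\mathbb Z}$, $R_0^{\boldsymbol n}(\boldsymbol x)=\boldsymbol x+\boldsymbol n$ on $\mathbb R^2/\Gamma_0$. $\mathcal P_0$ is indexed by $\{0,\dots,10\}$; each atom is the image in $\mathbb R^2/\Gamma_0$ of the union of interiors of the following polygons (vertices in cyclic order) in the fundamental domain $[0,\varphi)\times[0,\varphi+3)$: - 0: $(0,0),(s,0),(s,1)$;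 $(s,0),(1,0),(1,1)$; $(1,0),(\varphi,0),(\varphi,1)$. - 1: $(0,0),(s,1),(0,1)$; $(s,0),(1,1),(s,1)$; $(1,0),(\varphi,1),(1,1)$. - 2: $(0,2),(s,\varphi+2),(0,\varphi+1)$. - 3: $(1,1),(\varphi,2),(\varphi,\varphi+2),(1,2)$. - 4: $(0,2),(1,\varphi+2),(1,\varphi+3)$. - 5: $(0,\varphi+1),(s,\varphi+2),(1,\varphi+3),(t,\varphi+2),(t,\varphi+3),(0,\varphi+2)$. - 6: $(0,\varphi+2),(t,\varphi+3),(0,\varphi+3)$; $(t,\varphi+2),(1,\varphi+3),(t,\varphi+3)$; $(1,\varphi+2),(\varphi,\varphi+3),(1,\varphi+3)$. - 7: $(0,1),(1,\varphi+2),(0,2)$; $(1,\varphi+1),(\varphi,\varphi+2),(\varphi,\varphi+3),(1,\varphi+2)$. - 8: $(s,1),(\varphi,\varphi+2),(s,2)$. - 9: $(0,1),(s,1),(s,2)$; $(s,1),(1,1),(1,2)$; $(1,1),(\varphi,1),(\varphi,2)$. - 10: $(0,1),(1,\varphi+1),(1,\varphi+2)$. $\mathcal P_{\mathcal U}$ is the topological partition of $\mathbb R^2/\mathbb Z^2$ indexed by $\{0,\dots,18\}$ whose atoms are the images of the interiors of the polygons with vertices 0: $(s,s),(2t,s),(s,2t)$; 1: $(2t,s),(1,s),(1,1),(s,1),(s,2t)$; 2: $(u,s),(t,s),(0,1)$; 3: $(0,s),(u,s),(0,1)$; 4: $(s,s),(s,2t),(t,1)$; 5: $(s,2t),(s,1),(t,1)$;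 6: $(t,s),(t,1),(0,1)$; 7: $(t,s),(s,s),(t,1)$; 8: $(s,0),(1,0),(s,t)$; 9: $(1,0),(1,t),(2t,s),(s,s)$; 10: $(1,t),(1,s),(2t,s)$; 11: $(s,t),(1,0),(s,s)$; 12: $(t,t),(t,s),(u,s)$; 13: $(s,0),(s,t),(t,s),(t,t)$; 14: $(t,0),(t,t),(u,s),(0,s)$; 15: $(t,0),(s,0),(t,t)$; 16: $(0,0),(t,0),(0,t)$; 17: $(t,0),(0,s),(0,t)$; 18: $(s,t),(s,s),(t,s)$. **Labelled induction.** Given a $\mathbb Z^2$-rotation $R$ on a torus $\mathbf T$, a topological partition $\mathcal P=\{P_a\}$ of $\mathbf T$ indexed by nonnegative integers, an open $W\subset\mathbf T$ and $i\in\{1,2\}$: for $\boldsymbol x\in W$ let $r(\boldsymbol x)$ be the least $r\ge1$ with $R^{r\boldsymbol e_i}(\boldsymbol x)\in W$, and, if no $R^{k\boldsymbol e_i}(\boldsymbol x)$ with $0\le k<r(\boldsymbol x)$ lies on the boundary of an atom, let $w(\boldsymbol x)$ be the word of length $r(\boldsymbol x)$ whose $k$-th letter is the index of the atom containing $R^{k\boldsymbol e_i}(\boldsymbol x)$. List in radix order (shorter words first, words of the same length lexicographically) the words $w_0,w_1,\dots$ for which $\{\boldsymbol x\in W: w(\boldsymbol x)=w_b\}$ has nonempty interior. $\mathrm{Ind}_i(\mathcal P,R,W)=(\mathcal Q,\beta)$ where $Q_b$ is the interior of $\{\boldsymbol x\in W:w(\boldsymbol x)=w_b\}$ and $\beta(b)=w_b$,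 written as a row if $i=1$, as a column from bottom to top if $i=2$. In the steps below $W$ is identified (up to boundary) with the indicated next torus. **The maps $\beta_i$.** - $(\mathcal P_1,\beta_0)=\mathrm{Ind}_2(\mathcal P_0,R_0,(0,\varphi)\times(0,1))$, on $\mathbb R^2/(\varphi\mathbb Z\times\mathbb Z)$. - $\mathcal P_2=\mathcal P_1$, $R_2^{\boldsymbol n}(\boldsymbol x)=\boldsymbol x+(n_1,\varphi^{-2}n_2)$ on $\mathbb R^2/(\varphi\mathbb Z\times\mathbb Z)$, and $\beta_1=\theta_M$. - $(\mathcal P_3,\beta_2)=\mathrm{Ind}_1(\mathcal P_2,R_2,(0,1)^2)$, on $\mathbb R^2/\mathbb Z^2$ with $R_3^{\boldsymbol n}(\boldsymbol x)=\boldsymbol x+\varphi^{-2}\boldsymbol n$. - $(\mathcal P_4,\beta_3)=\mathrm{Ind}_1(\mathcal P_3,R_3,(0,s)\times(0,1))$, on $\mathbb R^2/(s\mathbb Z\times\mathbb Z)$ with $R_4^{\boldsymbol n}(\boldsymbol x)=\boldsymbol x+(-\varphi^{-3}n_1,\varphi^{-2}n_2)$. - $(\mathcal P_5,\beta_4)=\mathrm{Ind}_2(\mathcal P_4,R_4,(0,s)^2)$, on $\mathbb R^2/(s\mathbb Z)^2$. - With $h(\boldsymbol x)=-\varphi\boldsymbol x$, $h:\mathbb R^2/(s\mathbb Z)^2\to\mathbb R^2/\mathbb Z^2$, put $\mathcal P_5'=h(\mathcal P_5)$ and $(\mathcal P_6,\beta_5)=\mathrm{Ind}_1(\mathcal P_5',R_3,(0,s)\times(0,1))$,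 on $\mathbb R^2/(s\mathbb Z\times\mathbb Z)$. - $(\mathcal P_7,\beta_6)=\mathrm{Ind}_2(\mathcal P_6,R_4,(0,s)^2)$, $\mathcal P_7'=h(\mathcal P_7)$, $(\mathcal P_8,\beta_7)=\mathrm{Ind}_1(\mathcal P_7',R_3,(0,s)\times(0,1))$. - $(\mathcal P_9,\beta_8)=\mathrm{Ind}_2(\mathcal P_8,R_4,(0,s)^2)$, $\mathcal P_9'=h(\mathcal P_9)$, $(\mathcal P_{10},\beta_9)=\mathrm{Ind}_1(\mathcal P_9',R_3,(0,s)\times(0,1))$. - $\tau$ is the bijection from the index set of $\mathcal P_8$ to that of $\mathcal P_{10}$ such that the atom of $\mathcal P_{10}$ of index $\tau(a)$ is the atom of $\mathcal P_8$ of index $a$. - $\zeta$ is the bijection from $\{0,\dots,18\}$ to the index set of $\mathcal P_8$ such that $g$ maps the atom of $\mathcal P_8$ of index $\zeta(a)$ to the atom of $\mathcal P_{\mathcal U}$ of index $a$, where $g:\mathbb R^2/(s\mathbb Z\times\mathbb Z)\to\mathbb R^2/\mathbb Z^2$, $g(x,y)=(-\varphi x,y)$. (Atoms of the partitions are considered up to sets contained in finitely many line segments.) **The maps on the Wang-shift side.** - $\omega_0\omega_1\omega_2\omega_3$: $0\mapsto\langle0,9,3,7\rangle$, $1\mapsto\langle0,9,7,5\rangle$, $2\mapsto\langle0,9,10,4\rangle$, $3\mapsto\langle1,3,3,7\rangle$, $4\mapsto\langle1,3,7,6\rangle$, $5\mapsto\langle1,3,8,7\rangle$, $6\mapsto\langle1,7,2,5\rangle$,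 $7\mapsto\langle1,7,5,5\rangle$, $8\mapsto\langle1,7,5,6\rangle$, $9\mapsto\langle1,8,7,5\rangle$, $10\mapsto\langle1,8,10,4\rangle$, $11\mapsto\langle1,10,4,5\rangle$, $12\mapsto\langle1,10,4,6\rangle$, $13\mapsto\langle0,9,3,3,7\rangle$, $14\mapsto\langle0,9,3,7,6\rangle$, $15\mapsto\langle0,9,3,8,7\rangle$, $16\mapsto\langle0,9,7,2,5\rangle$, $17\mapsto\langle0,9,7,2,6\rangle$, $18\mapsto\langle0,9,7,5,5\rangle$, $19\mapsto\langle0,9,7,5,6\rangle$, $20\mapsto\langle0,9,8,7,5\rangle$, $21\mapsto\langle0,9,8,10,4\rangle$, $22\mapsto\langle0,9,10,4,6\rangle$, $23\mapsto\langle1,3,3,7,6\rangle$, $24\mapsto\langle1,3,8,7,6\rangle$, $25\mapsto\langle1,7,2,5,6\rangle$, $26\mapsto\langle1,8,10,4,6\rangle$, $27\mapsto\langle1,10,4,5,6\rangle$. - $\jmath\,\eta\,\omega_6=\theta_M\circ\kappa$ with $\kappa$: $0\mapsto2$, $1\mapsto9$, $2\mapsto10$, $3\mapsto20$, $4\mapsto21$, $5\mapsto22$, $6\mapsto26$, $7\mapsto[1,0]$, $8\mapsto[6,5]$, $9\mapsto[7,4]$, $10\mapsto[8,4]$, $11\mapsto[11,3]$, $12\mapsto[12,3]$, $13\mapsto[16,15]$, $14\mapsto[17,15]$, $15\mapsto[18,14]$, $16\mapsto[19,14]$, $17\mapsto[22,13]$, $18\mapsto[25,24]$, $19\mapsto[27,23]$.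 - $\omega_7$: $0\mapsto8$, $1\mapsto9$, $2\mapsto10$, $3\mapsto15$, $4\mapsto16$, $5\mapsto18$, $6\mapsto19$, $7\mapsto[7,0]$, $8\mapsto[7,2]$, $9\mapsto[8,1]$, $10\mapsto[11,2]$, $11\mapsto[12,2]$, $12\mapsto[13,3]$, $13\mapsto[14,3]$, $14\mapsto[15,5]$, $15\mapsto[15,6]$, $16\mapsto[16,5]$, $17\mapsto[16,6]$, $18\mapsto[17,4]$, $19\mapsto[19,6]$. - $\omega_8$: $0\mapsto3$, $1\mapsto4$, $2\mapsto5$, $3\mapsto6$, $4\mapsto12$, $5\mapsto13$, $6\mapsto14$, $7\mapsto15$, $8\mapsto18$, $9\mapsto\langle4,0\rangle$, $10\mapsto\langle5,0\rangle$, $11\mapsto\langle5,1\rangle$, $12\mapsto\langle5,2\rangle$, $13\mapsto\langle6,0\rangle$, $14\mapsto\langle13,8\rangle$, $15\mapsto\langle14,10\rangle$, $16\mapsto\langle15,10\rangle$, $17\mapsto\langle16,11\rangle$, $18\mapsto\langle17,9\rangle$, $19\mapsto\langle17,11\rangle$, $20\mapsto\langle18,7\rangle$, $21\mapsto\langle19,9\rangle$. - $\omega_9$: $0\mapsto8$, $1\mapsto14$, $2\mapsto17$, $3\mapsto20$, $4\mapsto[4,1]$, $5\mapsto[5,1]$, $6\mapsto[6,3]$, $7\mapsto[7,2]$, $8\mapsto[8,0]$, $9\mapsto[14,9]$, $10\mapsto[15,13]$, $11\mapsto[16,10]$, $12\mapsto[16,11]$, $13\mapsto[17,13]$, $14\mapsto[18,12]$,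 $15\mapsto[19,10]$, $16\mapsto[19,11]$, $17\mapsto[21,12]$. - $\omega_{10}$: $0\mapsto1$, $1\mapsto2$, $2\mapsto3$, $3\mapsto12$, $4\mapsto13$, $5\mapsto14$, $6\mapsto15$, $7\mapsto16$, $8\mapsto17$, $9\mapsto\langle1,0\rangle$, $10\mapsto\langle2,0\rangle$, $11\mapsto\langle3,0\rangle$, $12\mapsto\langle9,8\rangle$, $13\mapsto\langle10,4\rangle$, $14\mapsto\langle11,4\rangle$, $15\mapsto\langle12,6\rangle$, $16\mapsto\langle13,5\rangle$, $17\mapsto\langle13,8\rangle$, $18\mapsto\langle14,7\rangle$, $19\mapsto\langle15,5\rangle$, $20\mapsto\langle17,7\rangle$. - $\omega_{11}$: $0\mapsto5$, $1\mapsto8$, $2\mapsto14$, $3\mapsto15$, $4\mapsto18$, $5\mapsto20$, $6\mapsto[3,1]$, $7\mapsto[4,2]$, $8\mapsto[5,1]$, $9\mapsto[6,0]$, $10\mapsto[7,1]$, $11\mapsto[8,1]$, $12\mapsto[12,11]$, $13\mapsto[13,11]$, $14\mapsto[14,9]$, $15\mapsto[15,10]$, $16\mapsto[16,11]$, $17\mapsto[17,11]$, $18\mapsto[19,9]$. - $\rho$: $0\mapsto0$, $1\mapsto1$, $2\mapsto9$, $3\mapsto7$, $4\mapsto8$, $5\mapsto11$, $6\mapsto10$, $7\mapsto6$, $8\mapsto2$, $9\mapsto4$, $10\mapsto5$, $11\mapsto3$, $12\mapsto18$, $13\mapsto14$, $14\mapsto16$, $15\mapsto13$, $16\mapsto12$,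 $17\mapsto17$, $18\mapsto15$. - $\omega_{\mathcal U}$: $0\mapsto17$, $1\mapsto16$, $2\mapsto[15,11]$, $3\mapsto[13,9]$, $4\mapsto[17,8]$, $5\mapsto[16,8]$, $6\mapsto[15,8]$, $7\mapsto[14,8]$, $8\mapsto\langle14,6\rangle$, $9\mapsto\langle17,3\rangle$, $10\mapsto\langle16,3\rangle$, $11\mapsto\langle14,2\rangle$, $12\mapsto\begin{pmatrix}7&1\\15&11\end{pmatrix}$, $13\mapsto\begin{pmatrix}6&1\\14&11\end{pmatrix}$, $14\mapsto\begin{pmatrix}7&1\\13&9\end{pmatrix}$, $15\mapsto\begin{pmatrix}6&1\\12&9\end{pmatrix}$, $16\mapsto\begin{pmatrix}5&1\\18&10\end{pmatrix}$, $17\mapsto\begin{pmatrix}4&1\\13&9\end{pmatrix}$, $18\mapsto\begin{pmatrix}2&0\\14&8\end{pmatrix}$. *)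

(* Defs.v *)
From mathcomp Require Import all_boot all_order all_algebra.
From mathcomp Require Import finmap.
From mathcomp Require Import all_classical all_reals all_analysis.

Set Implicit Arguments.
Unset Strict Implicit.
Unset Printing Implicit Defensive.

Import Order.TTheory GRing.Theory Num.Theory.
Import numFieldNormedType.Exports.

Local Open Scope classical_set_scope.
Local Open Scope ring_scope.

(* A (nonempty) word is the list of its columns, from left to right; each
   column is listed from bottom to top, and all columns have the same size. *)
Definition word2 := seq (seq nat).

Definition width (w : word2) : nat := size w.
Definition height (w : word2) : nat := size (head [::] w).

Definition letter (a : nat) : word2 := [:: [:: a]].
Definition row_word (w : seq nat) : word2 := [seq [:: a] | a <- w].
Definition col_word (w : seq nat) : word2 := [:: w].
(* bottom row a, b and top row c, d *)
Definition block_word (c d a b : nat) : word2 := [:: [:: a; c]; [:: b; d]].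

Inductive direction := E1 | E2.

Definition word_along (i : direction) : seq nat -> word2 :=
  if i is E1 then row_word else col_word.

Definition unit_step (i : direction) (k : nat) : int * int :=
  if i is E1 then (k%:Z, 0) else (0, k%:Z).

(* Concatenation in direction i is defined only when the shapes agree. *)
Definition concat (i : direction) (u v : word2) : option word2 :=
  match i with
  | E1 => if height u == height v then Some (u ++ v) else None
  | E2 => if width u == width v
          then Some [seq p.1 ++ p.2 | p <- zip u v] else None
  end.

Fixpoint concat_all (i : direction) (us : seq (option word2)) : option word2 :=
  match us with
  | [::] => None
  | [:: u] => u
  | u :: us' => obind (fun v => obind (concat i v) (concat_all i us')) u
  end.

(* A 2-dimensional morphism on the alphabet {0, ..., size f - 1}, as the list
   of the images of the letters. *)
Definition morphism := seq word2.

Definition apply_morphism (f : morphism) (u : word2) : option word2 :=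
  concat_all E1 [seq concat_all E2 [seq onth f a | a <- c] | c <- u].

(* The composition f \o g; it is None if some image f (g a) is undefined. *)
Fixpoint compose (f g : morphism) : option morphism :=
  if g is w :: g'
  then obind (fun v => omap (cons v) (compose f g')) (apply_morphism f w)
  else Some [::].

(* A bijection between index sets {0, ..., m - 1} and {0, ..., n - 1}, as the
   list of its values. *)
Definition index_bijection (m n : nat) (t : seq nat) : Prop :=
  size t = m /\ perm_eq t (iota 0 n).

Definition recoding (t : seq nat) : morphism := [seq letter a | a <- t].

Definition inverse_bijection (t : seq nat) : seq nat :=
  [seq index a t | a <- iota 0 (size t)].

Definition configuration := int * int -> nat.

(* A word as a partial map on Z^2 with its lower-left corner at the origin. *)
Definition word_pattern (w : word2) (n : int * int) : option nat :=
  match n with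
  | (Posz i, Posz j) => onth (nth [::] w i) j
  | _ => None
  end.

(* y is the image of x, with the lower-left corner of the image of x 0 at the
   origin: the image of x n occupies the rectangle
   [c1 n.1, c1 (n.1 + 1)) x [c2 n.2, c2 (n.2 + 1)). *)
Definition configuration_image (f : morphism) (x y : configuration) : Prop :=
  exists c1 c2 : int -> int, [/\ c1 0 = 0, c2 0 = 0 &
    forall n : int * int, exists w : word2,
      [/\ onth f (x n) = Some w,
          c1 (n.1 + 1) = c1 n.1 + (width w)%:Z,
          c2 (n.2 + 1) = c2 n.2 + (height w)%:Z &
          forall (k : int * int) (a : nat), word_pattern w k = Some a ->
            y (c1 n.1 + k.1, c2 n.2 + k.2) = a]].

(* theta_M for M = ((1, 1), (0, 1)), whose inverse is ((1, -1), (0, 1)).  The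
   codomain T is nat for configurations and option nat for words. *)
Definition theta_M (T : Type) (w : int * int -> T) : int * int -> T :=
  fun n => w (n.1 - n.2, n.2).

Definition radix (v w : seq nat) : bool :=
  (size v < size w)%N ||
  (size v == size w) && (v <= w :> seqlexi nat)%O.

(* The morphism omega_0 \o omega_1 \o omega_2 \o omega_3. *)
Definition omega0123 : morphism :=
  [:: col_word [:: 0; 9; 3; 7]; col_word [:: 0; 9; 7; 5];
      col_word [:: 0; 9; 10; 4]; col_word [:: 1; 3; 3; 7];
      col_word [:: 1; 3; 7; 6]; col_word [:: 1; 3; 8; 7];
      col_word [:: 1; 7; 2; 5]; col_word [:: 1; 7; 5; 5];
      col_word [:: 1; 7; 5; 6]; col_word [:: 1; 8; 7; 5];
      col_word [:: 1; 8; 10; 4]; col_word [:: 1; 10; 4; 5];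
      col_word [:: 1; 10; 4; 6]; col_word [:: 0; 9; 3; 3; 7];
      col_word [:: 0; 9; 3; 7; 6]; col_word [:: 0; 9; 3; 8; 7];
      col_word [:: 0; 9; 7; 2; 5]; col_word [:: 0; 9; 7; 2; 6];
      col_word [:: 0; 9; 7; 5; 5]; col_word [:: 0; 9; 7; 5; 6];
      col_word [:: 0; 9; 8; 7; 5]; col_word [:: 0; 9; 8; 10; 4];
      col_word [:: 0; 9; 10; 4; 6]; col_word [:: 1; 3; 3; 7; 6];
      col_word [:: 1; 3; 8; 7; 6]; col_word [:: 1; 7; 2; 5; 6];
      col_word [:: 1; 8; 10; 4; 6]; col_word [:: 1; 10; 4; 5; 6]]%N.

(* theta_M \o kappa is the map jmath \o eta \o omega_6. *)
Definition kappa : morphism :=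
  [:: letter 2; letter 9; letter 10; letter 20; letter 21; letter 22;
      letter 26; row_word [:: 1; 0]; row_word [:: 6; 5]; row_word [:: 7; 4];
      row_word [:: 8; 4]; row_word [:: 11; 3]; row_word [:: 12; 3];
      row_word [:: 16; 15]; row_word [:: 17; 15]; row_word [:: 18; 14];
      row_word [:: 19; 14]; row_word [:: 22; 13]; row_word [:: 25; 24];
      row_word [:: 27; 23]]%N.

Definition omega7 : morphism :=
  [:: letter 8; letter 9; letter 10; letter 15; letter 16; letter 18;
      letter 19; row_word [:: 7; 0]; row_word [:: 7; 2]; row_word [:: 8; 1];
      row_word [:: 11; 2]; row_word [:: 12; 2]; row_word [:: 13; 3];
      row_word [:: 14; 3]; row_word [:: 15; 5]; row_word [:: 15; 6];
      row_word [:: 16; 5]; row_word [:: 16; 6]; row_word [:: 17; 4];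
      row_word [:: 19; 6]]%N.

Definition omega8 : morphism :=
  [:: letter 3; letter 4; letter 5; letter 6; letter 12; letter 13; letter 14;
      letter 15; letter 18; col_word [:: 4; 0]; col_word [:: 5; 0];
      col_word [:: 5; 1]; col_word [:: 5; 2]; col_word [:: 6; 0];
      col_word [:: 13; 8]; col_word [:: 14; 10]; col_word [:: 15; 10];
      col_word [:: 16; 11]; col_word [:: 17; 9]; col_word [:: 17; 11];
      col_word [:: 18; 7]; col_word [:: 19; 9]]%N.

Definition omega9 : morphism :=
  [:: letter 8; letter 14; letter 17; letter 20; row_word [:: 4; 1];
      row_word [:: 5; 1]; row_word [:: 6; 3]; row_word [:: 7; 2];
      row_word [:: 8; 0]; row_word [:: 14; 9]; row_word [:: 15; 13];
      row_word [:: 16; 10]; row_word [:: 16; 11]; row_word [:: 17; 13];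
      row_word [:: 18; 12]; row_word [:: 19; 10]; row_word [:: 19; 11];
      row_word [:: 21; 12]]%N.

Definition omega10 : morphism :=
  [:: letter 1; letter 2; letter 3; letter 12; letter 13; letter 14;
      letter 15; letter 16; letter 17; col_word [:: 1; 0]; col_word [:: 2; 0];
      col_word [:: 3; 0]; col_word [:: 9; 8]; col_word [:: 10; 4];
      col_word [:: 11; 4]; col_word [:: 12; 6]; col_word [:: 13; 5];
      col_word [:: 13; 8]; col_word [:: 14; 7]; col_word [:: 15; 5];
      col_word [:: 17; 7]]%N.

Definition omega11 : morphism :=
  [:: letter 5; letter 8; letter 14; letter 15; letter 18; letter 20;
      row_word [:: 3; 1]; row_word [:: 4; 2]; row_word [:: 5; 1];
      row_word [:: 6; 0]; row_word [:: 7; 1]; row_word [:: 8; 1];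
      row_word [:: 12; 11]; row_word [:: 13; 11]; row_word [:: 14; 9];
      row_word [:: 15; 10]; row_word [:: 16; 11]; row_word [:: 17; 11];
      row_word [:: 19; 9]]%N.

Definition rho : seq nat :=
  [:: 0; 1; 9; 7; 8; 11; 10; 6; 2; 4; 5; 3; 18; 14; 16; 13; 12; 17; 15]%N.

Definition omegaU : morphism :=
  [:: letter 17; letter 16; row_word [:: 15; 11]; row_word [:: 13; 9];
      row_word [:: 17; 8]; row_word [:: 16; 8]; row_word [:: 15; 8];
      row_word [:: 14; 8]; col_word [:: 14; 6]; col_word [:: 17; 3];
      col_word [:: 16; 3]; col_word [:: 14; 2]; block_word 7 1 15 11;
      block_word 6 1 14 11; block_word 7 1 13 9; block_word 6 1 12 9;
      block_word 5 1 18 10; block_word 4 1 13 9; block_word 2 0 14 8]%N.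

Section Tori.

Variable R : realType.

Local Notation plane := (R * R)%type.

(* The torus R^2 / L, where L is the lattice spanned by b.1 and b.2, is handled
   through its universal cover: a subset of the torus is represented by its
   preimage in R^2, an L-periodic set.  The projection being continuous and
   open, interiors, closures and boundaries in the torus correspond to those of
   the preimages.  A map between tori is represented by a lift. *)
Definition lattice (b : plane * plane) : set plane :=
  [set v | exists m n : int, v = (m%:~R * b.1.1 + n%:~R * b.2.1,
                                  m%:~R * b.1.2 + n%:~R * b.2.2)].

Definition periodize (b : plane * plane) (A : set plane) : set plane :=
  [set x | exists2 v, lattice b v & A (x.1 - v.1, x.2 - v.2)].

(* aZ x bZ *)
Definition rectangular (a b : R) : plane * plane := ((a, 0), (0, b)).

Definition box (a b : R) : set plane :=
  [set x | 0 < x.1 < a /\ 0 < x.2 < b].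

Definition boundary (A : set plane) : set plane := closure A `\` A°.

Definition segment (p q : plane) : set plane :=
  [set x | exists2 k : R, 0 <= k <= 1 &
     x = ((1 - k) * p.1 + k * q.1, (1 - k) * p.2 + k * q.2)].

(* Equality of subsets of a torus up to finitely many line segments. *)
Definition eq_mod_segments (b : plane * plane) (A B : set plane) : Prop :=
  exists l : seq (plane * plane),
    (A `\` B) `|` (B `\` A)
      `<=` periodize b (\big[setU/set0]_(e <- l) segment e.1 e.2).

(* The even-odd rule: the horizontal ray going right from x crosses the edge
   from p to q. *)
Definition crosses (x p q : plane) : bool :=
  ((p.2 <= x.2) != (q.2 <= x.2)) &&
  (x.1 < p.1 + (x.2 - p.2) / (q.2 - p.2) * (q.1 - p.1)).

(* The polygon with the given vertices in cyclic order, up to its boundary; it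
   need not be convex. *)
Definition polygon (vs : seq plane) : set plane :=
  [set x | odd (count (fun e => crosses x e.1 e.2) (zip vs (rot 1 vs)))].

(* Topological partitions, as the list of their atoms. *)
Definition partition := seq (set plane).

Definition polygon_partition (b : plane * plane) (l : seq (seq (seq plane))) :
    partition :=
  [seq periodize b (\big[setU/set0]_(vs <- ps) (polygon vs)°) | ps <- l].

Definition atom (P : partition) (a : nat) : set plane := nth set0 P a.

Definition action := int * int -> plane -> plane.

Definition is_return_time (T : action) (W : set plane) (i : direction)
    (x : plane) (r : nat) : Prop :=
  [/\ (0 < r)%N, W (T (unit_step i r) x) &
      forall k, (0 < k < r)%N -> ~ W (T (unit_step i k) x)].

(* w(x) is defined and equal to w *)
Definition has_return_word (P : partition) (T : action) (W : set plane)
    (i : direction) (x : plane) (w : seq nat) : Prop :=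
  is_return_time T W i x (size w) /\
  forall k, (k < size w)%N ->
    (forall a, (a < size P)%N -> ~ boundary (atom P a) (T (unit_step i k) x)) /\
    atom P (nth 0%N w k) (T (unit_step i k) x).

Definition return_cell (P : partition) (T : action) (W : set plane)
    (i : direction) (w : seq nat) : set plane :=
  [set x | W x /\ has_return_word P T W i x w]°.

(* fset_set A is the finite set A (and is empty if A is infinite). *)
Definition return_words (P : partition) (T : action) (W : set plane)
    (i : direction) : seq (seq nat) :=
  sort radix (fset_set [set w | return_cell P T W i w !=set0]).

(* Ind_i(P, T, W) for W = (0, a) x (0, b), P being a partition of R^2 / L.  The
   window W is identified with the torus R^2 / (aZ x bZ): each atom Q of the
   induced partition is cut to the rectangle and made (aZ x bZ)-periodic. *)
Definition induced_partition (i : direction) (L : plane * plane)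
    (P : partition) (T : action) (a b : R) : partition :=
  let W := periodize L (box a b) in
  [seq periodize (rectangular a b) (return_cell P T W i w `&` box a b)
     | w <- return_words P T W i].

Definition induced_morphism (i : direction) (L : plane * plane)
    (P : partition) (T : action) (a b : R) : morphism :=
  [seq word_along i w | w <- return_words P T (periodize L (box a b)) i].

Definition phi : R := (1 + Num.sqrt 5) / 2.

Local Notation s := (phi ^- 1).
Local Notation t := (phi ^- 2).
Local Notation u := (phi ^- 3).

Definition Gamma0 : plane * plane := ((phi, 0), (1, phi + 3)).

Definition rot0 : action := fun n x => (x.1 + n.1%:~R, x.2 + n.2%:~R).
Definition rot2 : action := fun n x => (x.1 + n.1%:~R, x.2 + t * n.2%:~R).
Definition rot3 : action := fun n x => (x.1 + t * n.1%:~R, x.2 + t * n.2%:~R).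
Definition rot4 : action := fun n x => (x.1 - u * n.1%:~R, x.2 + t * n.2%:~R).

Definition part0 : partition := polygon_partition Gamma0
  [:: [:: [:: (0, 0); (s, 0); (s, 1)];
          [:: (s, 0); (1, 0); (1, 1)];
          [:: (1, 0); (phi, 0); (phi, 1)]];
      [:: [:: (0, 0); (s, 1); (0, 1)];
          [:: (s, 0); (1, 1); (s, 1)];
          [:: (1, 0); (phi, 1); (1, 1)]];
      [:: [:: (0, 2); (s, phi + 2); (0, phi + 1)]];
      [:: [:: (1, 1); (phi, 2); (phi, phi + 2); (1, 2)]];
      [:: [:: (0, 2); (1, phi + 2); (1, phi + 3)]];
      [:: [:: (0, phi + 1); (s, phi + 2); (1, phi + 3); (t, phi + 2);
           (t, phi + 3); (0, phi + 2)]];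
      [:: [:: (0, phi + 2); (t, phi + 3); (0, phi + 3)];
          [:: (t, phi + 2); (1, phi + 3); (t, phi + 3)];
          [:: (1, phi + 2); (phi, phi + 3); (1, phi + 3)]];
      [:: [:: (0, 1); (1, phi + 2); (0, 2)];
          [:: (1, phi + 1); (phi, phi + 2); (phi, phi + 3); (1, phi + 2)]];
      [:: [:: (s, 1); (phi, phi + 2); (s, 2)]];
      [:: [:: (0, 1); (s, 1); (s, 2)];
          [:: (s, 1); (1, 1); (1, 2)];
          [:: (1, 1); (phi, 1); (phi, 2)]];
      [:: [:: (0, 1); (1, phi + 1); (1, phi + 2)]]].

Definition partU : partition := polygon_partition (rectangular 1 1)
  [:: [:: [:: (s, s); (2 * t, s); (s, 2 * t)]];
      [:: [:: (2 * t, s); (1, s); (1, 1); (s, 1); (s, 2 * t)]];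
      [:: [:: (u, s); (t, s); (0, 1)]];
      [:: [:: (0, s); (u, s); (0, 1)]];
      [:: [:: (s, s); (s, 2 * t); (t, 1)]];
      [:: [:: (s, 2 * t); (s, 1); (t, 1)]];
      [:: [:: (t, s); (t, 1); (0, 1)]];
      [:: [:: (t, s); (s, s); (t, 1)]];
      [:: [:: (s, 0); (1, 0); (s, t)]];
      [:: [:: (1, 0); (1, t); (2 * t, s); (s, s)]];
      [:: [:: (1, t); (1, s); (2 * t, s)]];
      [:: [:: (s, t); (1, 0); (s, s)]];
      [:: [:: (t, t); (t, s); (u, s)]];
      [:: [:: (s, 0); (s, t); (t, s); (t, t)]];
      [:: [:: (t, 0); (t, t); (u, s); (0, s)]];
      [:: [:: (t, 0); (s, 0); (t, t)]];
      [:: [:: (0, 0); (t, 0); (0, t)]];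
      [:: [:: (t, 0); (0, s); (0, t)]];
      [:: [:: (s, t); (s, s); (t, s)]]].

Definition h (x : plane) : plane := (- phi * x.1, - phi * x.2).
Definition g (x : plane) : plane := (- phi * x.1, x.2).

Definition map_partition (f : plane -> plane) (P : partition) : partition :=
  [seq f @` A | A <- P].

Definition part1 := induced_partition E2 Gamma0 part0 rot0 phi 1.
Definition beta0 := induced_morphism E2 Gamma0 part0 rot0 phi 1.

Definition part2 := part1.
Definition beta1 (T : Type) := @theta_M T.

Definition part3 := induced_partition E1 (rectangular phi 1) part2 rot2 1 1.
Definition beta2 := induced_morphism E1 (rectangular phi 1) part2 rot2 1 1.

Definition part4 := induced_partition E1 (rectangular 1 1) part3 rot3 s 1.
Definition beta3 := induced_morphism E1 (rectangular 1 1) part3 rot3 s 1.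

Definition part5 := induced_partition E2 (rectangular s 1) part4 rot4 s s.
Definition beta4 := induced_morphism E2 (rectangular s 1) part4 rot4 s s.

Definition part5' := map_partition h part5.

Definition part6 := induced_partition E1 (rectangular 1 1) part5' rot3 s 1.
Definition beta5 := induced_morphism E1 (rectangular 1 1) part5' rot3 s 1.

Definition part7 := induced_partition E2 (rectangular s 1) part6 rot4 s s.
Definition beta6 := induced_morphism E2 (rectangular s 1) part6 rot4 s s.

Definition part7' := map_partition h part7.

Definition part8 := induced_partition E1 (rectangular 1 1) part7' rot3 s 1.
Definition beta7 := induced_morphism E1 (rectangular 1 1) part7' rot3 s 1.

Definition part9 := induced_partition E2 (rectangular s 1) part8 rot4 s s.
Definition beta8 := induced_morphism E2 (rectangular s 1) part8 rot4 s s.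

Definition part9' := map_partition h part9.

Definition part10 := induced_partition E1 (rectangular 1 1) part9' rot3 s 1.
Definition beta9 := induced_morphism E1 (rectangular 1 1) part9' rot3 s 1.

Definition is_tau (tau : seq nat) : Prop :=
  index_bijection (size part8) (size part10) tau /\
  forall a, (a < size part8)%N ->
    eq_mod_segments (rectangular s 1) (atom part10 (nth 0%N tau a))
                    (atom part8 a).

Definition is_zeta (zeta : seq nat) : Prop :=
  index_bijection 19 (size part8) zeta /\
  forall a, (a < 19)%N ->
    eq_mod_segments (rectangular 1 1) (g @` atom part8 (nth 0%N zeta a))
                    (atom partU a).

End Tori.

(* Main.v *)
(* All lines bounding atoms have coefficients in Z[phi], and all return times are
   at most 5.  So each partition is described, off a locally finite family of
   lines, by a decision tree whose nodes test the sign of an affine form over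
   Z[phi].  Following the orbit of a point symbolically through such a tree, and
   discarding the empty branches by Farkas certificates made of three forms, gives
   a decision tree for the return word, hence one for the induced partition.
   Its leaves are all the return words: an open set of points with another return
   word would lie in the exceptional lines.  A sample point with nonzero sign at
   each node shows conversely that a word occurs on an open set.  The equalities
   of partitions behind tau and zeta also amount to comparing two trees. *)

(* Only soundness is proved about the computations. A branch that pruning fails to discard, an orbit
   point for which no lattice translate is found, or a sampling grid that is too coarse can only
   make a boolean check fail. The obstacle is that the trees say nothing on their lines, whereas
   return words are defined pointwise and mention boundaries. Hence statements about partitions hold
   up to a [small] set, and cells are compared through their interiors: small sets have dense
   complement and small closure, so a set that agrees with a tree off a small set has, off another
   one, the same interior and no boundary point. This is how the error of one induction is absorbed
   by the next. The orbit lives in the plane while a tree is valid only on a fundamental domain. The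
   computation therefore carries the displacement from the starting point to the reduced point, and
   every test is pulled back to an affine form in the starting point. *)
From Stdlib Require Import ZArith.
Require Import Defs.
From mathcomp Require Import all_boot all_order all_algebra.
From mathcomp Require Import finmap.
From mathcomp Require Import all_classical all_reals all_analysis.
From mathcomp Require Import zify ssrZ ring lra.

Set Implicit Arguments.
Unset Strict Implicit.
Unset Printing Implicit Defensive.

Import Order.TTheory GRing.Theory Num.Theory.
Import numFieldNormedType.Exports.

Local Open Scope classical_set_scope.
Local Open Scope ring_scope.

(** * Decision trees over Z[phi] *)

(* [(a, b)] stands for [a + b phi]. *)
Definition zphi := (Z * Z)%type.

Definition zadd (x y : zphi) : zphi := (Z.add x.1 y.1, Z.add x.2 y.2).
Definition zopp (x : zphi) : zphi := (Z.opp x.1, Z.opp x.2).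
Definition zsub (x y : zphi) : zphi := zadd x (zopp y).
Definition zmul (x y : zphi) : zphi :=
  (Z.add (Z.mul x.1 y.1) (Z.mul x.2 y.2),
   Z.add (Z.mul x.1 y.2) (Z.add (Z.mul x.2 y.1) (Z.mul x.2 y.2))).

(* [vm_compute] evaluates both arguments of [andb] and [orb]. *)
Local Notation "b &&& c" := (if b then c else false)
  (at level 40, left associativity).
Local Notation "b ||| c" := (if b then true else c)
  (at level 50, left associativity).

(* [2 (a + b phi) = p + b sqrt 5] where [p = 2 a + b]. *)
Definition zpos (x : zphi) : bool :=
  let p := Z.add (Z.add x.1 x.1) x.2 in
  let p2 := Z.mul p p in
  let q2 := Z.mul (Zpos 5) (Z.mul x.2 x.2) in
  (Z.ltb Z0 p &&& Z.ltb q2 p2) ||| (Z.ltb Z0 x.2 &&& Z.ltb p2 q2).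

Definition znonneg (x : zphi) : bool :=
  zpos x ||| (Z.eqb x.1 Z0 &&& Z.eqb x.2 Z0).

(* [(a, b, c)] stands for the affine form [x |-> a x.1 + b x.2 + c]. *)
Definition zaff := (zphi * zphi * zphi)%type.

(** Excludes constant forms, so that the zero set is a line. *)
Definition znormal (c : zaff) : bool :=
  [|| zpos c.1.1, zpos (zopp c.1.1), zpos c.1.2 | zpos (zopp c.1.2)].

Definition aopp (c : zaff) : zaff := (zopp c.1.1, zopp c.1.2, zopp c.2).

Definition zdet (c d : zaff) : zphi :=
  zsub (zmul c.1.1 d.1.2) (zmul c.1.2 d.1.1).

(** Positive forms have no nonnegative combination, with some positive weight, that is a nonpositive
    constant. Cancellation of the linear parts is not tested here: [refutes] chooses weights for
    which it holds identically. *)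
Definition farkas (l0 l1 l2 : zphi) (c0 c1 c2 : zaff) : bool :=
  znonneg l0 &&& znonneg l1 &&& znonneg l2 &&&
  (zpos l0 ||| zpos l1 ||| zpos l2) &&&
  znonneg (zopp (zadd (zmul l0 c0.2) (zadd (zmul l1 c1.2) (zmul l2 c2.2)))).

(* The coefficients form the only linear relation between three vectors of the
   plane, so this decides whether [c0], [c1], [c2] can be positive together. *)
Definition refutes (c0 c1 c2 : zaff) : bool :=
  let l0 := zdet c1 c2 in
  let l1 := zdet c2 c0 in
  let l2 := zdet c0 c1 in
  farkas l0 l1 l2 c0 c1 c2 ||| farkas (zopp l0) (zopp l1) (zopp l2) c0 c1 c2.

Fixpoint lazy_has (A : Type) (p : A -> bool) (s : seq A) : bool :=
  if s is x :: s' then p x ||| lazy_has p s' else false.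

Lemma lazy_hasE (A : Type) (p : A -> bool) s : lazy_has p s = has p s.
Proof. by elim: s => //= x s ->. Qed.

(** By Helly's theorem, an empty intersection of half-planes is already empty for at most three of
    them, and [c] is one of these when [cs] is consistent. Two opposite parallel forms are caught
    with any transversal third one, whose weight is then zero. *)
Fixpoint refuted (c : zaff) (cs : seq zaff) : bool :=
  if cs is c1 :: cs' then lazy_has (refutes c c1) cs' ||| refuted c cs'
  else false.

Inductive tree (A : Type) := Leaf of A | Node of zaff & tree A & tree A.
Arguments Leaf {A}.
Arguments Node {A}.

(** Merging equal leaves keeps the trees small over the successive inductions. It may drop a line,
    which only enlarges the set of regular points. *)
Definition node (A : eqType) (c : zaff) (T U : tree A) : tree A :=
  match T, U with
  | Leaf a, Leaf b => if a == b then Leaf a else Node c T U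
  | _, _ => Node c T U
  end.

(* The composite of [T] with the continuation [k], without the branches that
   are empty under the constraints [cs]. *)
Fixpoint explore (A : Type) (B : eqType) (cs : seq zaff) (T : tree A)
    (k : seq zaff -> A -> tree B) : tree B :=
  match T with
  | Leaf a => k cs a
  | Node c T1 T2 =>
    if refuted c cs then explore cs T2 k
    else if refuted (aopp c) cs then explore cs T1 k
    else node c (explore (c :: cs) T1 k) (explore (aopp c :: cs) T2 k)
  end.

Fixpoint leaves (A : Type) (T : tree A) : seq A :=
  match T with
  | Leaf a => [:: a]
  | Node _ T1 T2 => leaves T1 ++ leaves T2
  end.

Fixpoint tmap (A B : Type) (f : A -> B) (T : tree A) : tree B :=
  match T with
  | Leaf a => Leaf (f a)
  | Node c T1 T2 => Node c (tmap f T1) (tmap f T2)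
  end.

Fixpoint wf (A : Type) (T : tree A) : bool :=
  match T with
  | Leaf _ => true
  | Node c T1 T2 => [&& znormal c, wf T1 & wf T2]
  end.

Lemma wf_tmap (A B : Type) (f : A -> B) T : wf (tmap f T) = wf T.
Proof. by elim: T => //= c T1 -> T2 ->. Qed.

Lemma leaves_tmap (A B : Type) (f : A -> B) T :
  leaves (tmap f T) = map f (leaves T).
Proof. by elim: T => //= c T1 -> T2 ->; rewrite map_cat. Qed.

(* [asubst p q c] is [c] composed with [x |-> (p.1 + q.1 x.1, p.2 + q.2 x.2)]. *)
Definition asubst (p q : zphi * zphi) (c : zaff) : zaff :=
  (zmul c.1.1 q.1, zmul c.1.2 q.2,
   zadd c.2 (zadd (zmul c.1.1 p.1) (zmul c.1.2 p.2))).

Fixpoint tsubst (A : Type) (p q : zphi * zphi) (T : tree A) : tree A :=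
  match T with
  | Leaf a => Leaf a
  | Node c T1 T2 => Node (asubst p q c) (tsubst p q T1) (tsubst p q T2)
  end.

Definition zz (n : Z) : zphi := (n, Z0).
Definition tshift (A : Type) (d : zphi * zphi) : tree A -> tree A :=
  tsubst d (zz 1, zz 1).

Definition conj_tree (cs : seq zaff) : tree bool :=
  foldr (fun c T => Node c T (Leaf false)) (Leaf true) cs.

(** The second coordinate is tested first: on a sheared lattice, the first coordinate of a translate
    is under control only once the second lies in range ([tame_box_tree]). *)
Definition box_forms (a b : zphi) : seq zaff :=
  [:: (zz 0, zz 1, zz 0); (zz 0, zz (-1), b);
      (zz 1, zz 0, zz 0); (zz (-1), zz 0, a)].

(** * Values of forms and trees at real points *)

Section Semantics.
Variable R : realType.
Local Notation plane := (R * R)%type.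
Local Notation phi := (phi R).

Lemma phi_sqr : phi ^+ 2 = phi + 1.
Proof.
rewrite /Defs.phi; have := @sqr_sqrtr R 5 (ler0n _ _).
by set r := Num.sqrt 5 => hr; field: hr.
Qed.

Lemma phi_gt1 : 1 < phi.
Proof.
rewrite /Defs.phi; have h : 1 < Num.sqrt 5 :> R.
  by rewrite -{1}sqrtr1 ltr_sqrt // ltr1n.
lra.
Qed.

Definition zval (x : zphi) : R :=
  (int_of_Z x.1)%:~R + (int_of_Z x.2)%:~R * phi.

Let zr (n : Z) : R := (int_of_Z n)%:~R.
Let zrD m n : zr (Z.add m n) = zr m + zr n.
Proof. by rewrite /zr (rmorphD int_of_Z) rmorphD. Qed.
Let zrN m : zr (Z.opp m) = - zr m.
Proof. by rewrite /zr (rmorphN int_of_Z) rmorphN. Qed.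
Let zrM m n : zr (Z.mul m n) = zr m * zr n.
Proof. by rewrite /zr (rmorphM int_of_Z) rmorphM. Qed.
Let zr_lt m n : Z.ltb m n -> zr m < zr n.
Proof. by rewrite /zr ltr_int; lia. Qed.

Lemma zvalD x y : zval (zadd x y) = zval x + zval y.
Proof. by rewrite /zval -!/(zr _) !zrD; ring. Qed.

Lemma zvalN x : zval (zopp x) = - zval x.
Proof. by rewrite /zval -!/(zr _) !zrN; ring. Qed.

Lemma zvalB x y : zval (zsub x y) = zval x - zval y.
Proof. by rewrite zvalD zvalN. Qed.

Lemma zvalM x y : zval (zmul x y) = zval x * zval y.
Proof.
rewrite /zval -!/(zr _) /= !(zrD, zrM); have := phi_sqr; move: phi => f hf.
by ring: hf.
Qed.

Lemma zval_zz n : zval (zz n) = (int_of_Z n)%:~R.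
Proof. by rewrite /zval /= mul0r addr0. Qed.

Lemma zval0 : zval (zz 0) = 0. Proof. exact: zval_zz. Qed.
Lemma zval1 : zval (zz 1) = 1. Proof. exact: zval_zz. Qed.
Lemma zvalN1 : zval (zz (-1)) = -1. Proof. by rewrite zval_zz. Qed.

Definition zvalE := (zval0, zval1, zvalN1, zvalD, zvalN, zvalB, zvalM).

(** If the sum were nonpositive, the positive summand would be at most the opposite of the other,
    and squaring would contradict the comparison of squares. *)
Lemma sqrt5_comb (p q r : R) : r ^+ 2 = 5 -> 0 < r ->
  0 < p /\ 5 * (q * q) < p * p \/ 0 < q /\ p * p < 5 * (q * q) ->
  0 < p + q * r.
Proof.
move=> r2 r0 h; rewrite ltNge; apply/negP => le0.
case: h => -[h0 h].
- have h1 : p <= - (q * r) by lra.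
  have : p * p <= - (q * r) * - (q * r) by apply: ler_pM => //; lra.
  have -> : - (q * r) * - (q * r) = 5 * (q * q) by ring: r2.
  lra.
- have h1 : q * r <= - p by lra.
  have : (q * r) * (q * r) <= (- p) * (- p).
    by have := mulr_gt0 h0 r0 => h2; apply: ler_pM => //; lra.
  have -> : (q * r) * (q * r) = 5 * (q * q) by ring: r2.
  lra.
Qed.

Lemma zpos_gt0 x : zpos x -> 0 < zval x.
Proof.
rewrite /zpos => /orP h.
have sq5 := @sqr_sqrtr R 5 (ler0n _ _).
have r0 : 0 < Num.sqrt 5 :> R by rewrite sqrtr_gt0 ltr0n.
have -> : zval x = ((zr x.1 + zr x.1 + zr x.2) + zr x.2 * Num.sqrt 5) / 2.
  by rewrite /zval /Defs.phi -!/(zr _); field.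
rewrite divr_gt0 ?ltr0n //.
have z0 : zr Z0 = 0 by [].
have z5 : zr (Zpos 5) = 5 by [].
apply: sqrt5_comb => //.
by case: h => /andP[/zr_lt + /zr_lt]; rewrite !(zrM, zrD) z0 z5;
  [left|right].
Qed.

Lemma znonneg_ge0 x : znonneg x -> 0 <= zval x.
Proof.
rewrite /znonneg; case: ifP => [/zpos_gt0/ltW//|_].
case: ifP => // /Z.eqb_eq + /Z.eqb_eq.
by rewrite /zval => -> ->; rewrite /= mul0r addr0.
Qed.

Definition aff := (R * R * R)%type.
Definition ev (c : aff) (x : plane) : R := c.1.1 * x.1 + c.1.2 * x.2 + c.2.
Definition nondeg (c : aff) : bool := (c.1.1 != 0) || (c.1.2 != 0).
Definition aval (c : zaff) : aff := (zval c.1.1, zval c.1.2, zval c.2).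
Definition zev (c : zaff) (x : plane) : R := ev (aval c) x.

Lemma znormal_nondeg c : znormal c -> nondeg (aval c).
Proof.
rewrite /nondeg /= => /or4P[] /zpos_gt0; rewrite ?zvalN ?oppr_gt0.
- by move/lt0r_neq0 => ->.
- by move/ltr0_neq0 => ->.
- by move/lt0r_neq0 => ->; rewrite orbT.
- by move/ltr0_neq0 => ->; rewrite orbT.
Qed.

Lemma zev_aopp c x : zev (aopp c) x = - zev c x.
Proof. by rewrite /zev /ev /= !zvalN; ring. Qed.

Definition sat (cs : seq zaff) (x : plane) : bool :=
  all (fun c => 0 < zev c x) cs.

(** [i] selects a coordinate of the normal vectors, so [rel] says that the linear parts cancel. *)
Lemma farkas_sound l0 l1 l2 c0 c1 c2 x :
  (forall i : bool, let f (c : zaff) := zval (if i then c.1.1 else c.1.2) in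
     zval l0 * f c0 + zval l1 * f c1 + zval l2 * f c2 = 0) ->
  farkas l0 l1 l2 c0 c1 c2 ->
  0 < zev c0 x -> 0 < zev c1 x -> 0 < zev c2 x -> False.
Proof.
move=> rel; case/andP=> /andP[/andP[/andP[/znonneg_ge0 n0 /znonneg_ge0 n1]
  /znonneg_ge0 n2] np] /znonneg_ge0.
rewrite zvalN !zvalD !zvalM => nv p0 p1 p2.
have := rel true; have := rel false; rewrite /= => r2 r1.
have h0 := mulr_ge0 n0 (ltW p0).
have h1 := mulr_ge0 n1 (ltW p1).
have h2 := mulr_ge0 n2 (ltW p2).
have E : zval l0 * zev c0 x + zval l1 * zev c1 x + zval l2 * zev c2 x =
   zval l0 * zval c0.2 + (zval l1 * zval c1.2 + zval l2 * zval c2.2).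
  transitivity (
    (zval l0 * zval c0.1.1 + zval l1 * zval c1.1.1 + zval l2 * zval c2.1.1) * x.1 +
    (zval l0 * zval c0.1.2 + zval l1 * zval c1.1.2 + zval l2 * zval c2.1.2) * x.2 +
    (zval l0 * zval c0.2 + (zval l1 * zval c1.2 + zval l2 * zval c2.2))).
    by rewrite /zev /ev /=; ring.
  by rewrite r1 r2; ring.
case/orP: np => [/orP[]|] /zpos_gt0 q.
- have := mulr_gt0 q p0; lra.
- have := mulr_gt0 q p1; lra.
- have := mulr_gt0 q p2; lra.
Qed.

Lemma refutes_sound c0 c1 c2 x : refutes c0 c1 c2 ->
  0 < zev c0 x -> 0 < zev c1 x -> 0 < zev c2 x -> False.
Proof.
case/orP; apply: farkas_sound => i; rewrite /zdet !zvalE; case: i; ring.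
Qed.

Lemma refuted_sound c cs x : refuted c cs -> sat cs x -> zev c x <= 0.
Proof.
elim: cs => //= c1 cs IH /orP[] + /andP[p1 /[dup] /allP h scs]; last first.
  by move=> /IH; apply.
rewrite lazy_hasE => /hasP[c2 i2 r]; rewrite leNgt; apply/negP => p.
exact: refutes_sound r p p1 (h _ i2).
Qed.

Fixpoint teval (A : Type) (T : tree A) (x : plane) : A :=
  match T with
  | Leaf a => a
  | Node c T1 T2 => if 0 < zev c x then teval T1 x else teval T2 x
  end.

(* [x] lies on none of the lines met when [T] is evaluated at [x]. *)
Fixpoint tregular (A : Type) (T : tree A) (x : plane) : bool :=
  match T with
  | Leaf _ => true
  | Node c T1 T2 =>
    (zev c x != 0) && (if 0 < zev c x then tregular T1 x else tregular T2 x)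
  end.

Lemma teval_node (A : eqType) c (T U : tree A) x :
  teval (node c T U) x = if 0 < zev c x then teval T x else teval U x.
Proof.
case: T U => [a|c1 T1 T2] [b|c2 U1 U2] //=.
by have [->|ne] //= := eqVneq a b; rewrite if_same.
Qed.

(** Phrased with a predicate [Q] on the value, so that it applies again inside the continuation.
    Regularity makes the second branch strict: the constraint recorded there is that [aopp c] is
    positive, not merely that [c] is nonpositive. *)
Lemma explore_sound (A : Type) (B : eqType) (Q : B -> Prop) x (T : tree A) cs k :
  sat cs x -> tregular T x ->
  (forall cs', sat cs' x -> Q (teval (k cs' (teval T x)) x)) ->
  Q (teval (explore cs T k) x).
Proof.
elim: T cs => [a|c T1 IH1 T2 IH2] cs h /=; first by move=> _; apply.
case/andP=> ne; case: ltP => hc rT hQ.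
- case: ifP => [/refuted_sound /(_ h)|_]; first lra.
  case: ifP => [_|_]; first exact: IH1.
  by rewrite teval_node hc; apply: IH1 => //=; rewrite hc.
- case: ifP => [_|_]; first exact: IH2.
  case: ifP => [/refuted_sound /(_ h)|_].
    by rewrite zev_aopp; move: ne hc; rewrite neq_lt => /orP; lra.
  rewrite teval_node ltNge hc /=; apply: IH2 => //=.
  by rewrite zev_aopp h andbT oppr_gt0 lt_def eq_sym ne hc.
Qed.

Lemma teval_leaves (A : eqType) (T : tree A) x : teval T x \in leaves T.
Proof.
elim: T => [a|c T1 IH1 T2 IH2] /=; first by rewrite inE.
by rewrite mem_cat; case: ifP => _; rewrite ?IH1 ?IH2 ?orbT.
Qed.

Lemma teval_tmap (A B : Type) (f : A -> B) T x : teval (tmap f T) x = f (teval T x).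
Proof. by elim: T => //= c T1 -> T2 ->; case: ifP. Qed.


Definition vval (p : zphi * zphi) : plane := (zval p.1, zval p.2).
Definition diag (p q : plane) (x : plane) : plane :=
  (p.1 + q.1 * x.1, p.2 + q.2 * x.2).

Lemma zev_asubst p q c x :
  zev (asubst p q c) x = zev c (diag (vval p) (vval q) x).
Proof. by rewrite /zev /ev /= !zvalE; ring. Qed.

Lemma teval_tsubst (A : Type) p q (T : tree A) x :
  teval (tsubst p q T) x = teval T (diag (vval p) (vval q) x).
Proof. by elim: T => //= c T1 -> T2 ->; rewrite zev_asubst. Qed.

Lemma tregular_tsubst (A : Type) p q (T : tree A) x :
  tregular (tsubst p q T) x = tregular T (diag (vval p) (vval q) x).
Proof. by elim: T => //= c T1 -> T2 ->; rewrite zev_asubst. Qed.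

Lemma diag1 d x : diag (vval d) (vval (zz 1, zz 1)) x = x + vval d.
Proof. by rewrite /diag /vval /= zval1 !mul1r addrC [zval d.2 + _]addrC. Qed.

Lemma teval_tshift (A : Type) d (T : tree A) x :
  teval (tshift d T) x = teval T (x + vval d).
Proof. by rewrite teval_tsubst diag1. Qed.

Lemma tregular_tshift (A : Type) d (T : tree A) x :
  tregular (tshift d T) x = tregular T (x + vval d).
Proof. by rewrite tregular_tsubst diag1. Qed.

Lemma teval_conj cs x : teval (conj_tree cs) x = sat cs x.
Proof. by elim: cs => //= c cs ->; case: ifP. Qed.

Lemma sat_box a b x :
  sat (box_forms a b) x <-> box (zval a) (zval b) x.
Proof.
rewrite /sat /box_forms /zev /ev /box /= !(zval0, zval1, zvalN1) andbT.
split=> [/and4P[]|[/andP[h1 h2] /andP[h3 h4]]].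
- by move=> h1 h2 h3 h4; split; apply/andP; split; lra.
- by apply/and4P; split; lra.
Qed.

End Semantics.

(** * Small sets *)

Section Small.
Variable R : realType.
Local Notation plane := (R * R)%type.
Implicit Types (A B : set plane) (x y z : plane) (c : aff R).

Definition near_pt (x : plane) (e : R) (y : plane) : Prop :=
  `|y.1 - x.1| < e /\ `|y.2 - x.2| < e.

Lemma near_pt_refl x e : 0 < e -> near_pt x e x.
Proof. by move=> e0; split; rewrite subrr normr0. Qed.

Lemma near_pt_le x e e' y : e <= e' -> near_pt x e y -> near_pt x e' y.
Proof. by move=> le [h1 h2]; split; apply: lt_le_trans le. Qed.

Lemma near_pt_ball x e y : near_pt x e y ->
  exists2 e', 0 < e' & forall z, near_pt y e' z -> near_pt x e z.
Proof.
move=> [h1 h2]; exists (Num.min (e - `|y.1 - x.1|) (e - `|y.2 - x.2|)).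
  by rewrite lt_min !subr_gt0 h1.
move=> z [k1 k2]; move: k1 k2; rewrite !lt_min => /andP[k1 _] /andP[_ k2].
have t1 := ler_normD (z.1 - y.1) (y.1 - x.1).
have t2 := ler_normD (z.2 - y.2) (y.2 - x.2).
rewrite !subrKA in t1 t2.
by split; [move: k1 t1|move: k2 t2]; lra.
Qed.

Definition lconst A x : Prop :=
  exists2 e, 0 < e & forall y, near_pt x e y -> (A y <-> A x).

Lemma interior_near A x :
  A° x <-> exists2 e, 0 < e & forall y, near_pt x e y -> A y.
Proof.
rewrite /interior /=; split.
  move/nbhs_ballP => [e /= e0 h]; exists e => // y [h1 h2].
  by apply: h; split; rewrite /= /ball /= distrC.
move=> [e e0 h]; apply/nbhs_ballP; exists e => // y [h1 h2].
by apply: h; split; rewrite distrC.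
Qed.

Lemma interior_lconst A x : A x -> lconst A x -> A° x.
Proof.
by move=> Ax [e e0 h]; apply/interior_near; exists e => // y /h ->.
Qed.

(** The complement of the boundary is the union of the interiors of [A] and of its complement. *)
Lemma boundary_lconst A x : ~ boundary A x <-> lconst A x.
Proof.
rewrite /boundary -[closure A]setCK -interiorC.
split=> [h|[e e0 h] /= [hc hi]].
  have [/interior_near [e e0 hA]|nA] := pselect (A° x).
    by exists e => // y /hA Ay; split=> // _; apply/hA/near_pt_refl.
  have [/interior_near [e e0 hA]|nA'] := pselect ((~` A)° x).
    by exists e => // y /hA Ay; split=> // Ax; case: (hA x (near_pt_refl x e0)).
  by case: h.
have [Ax|nAx] := pselect (A x).
  by apply: hi; apply/interior_lconst => //; exists e.
by apply: hc; apply/interior_near; exists e => // y /h hy Ay; apply/nAx/hy.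
Qed.

(* Contrary to being covered by finitely many segments, this is stable under
   periodization; both agree on periodic sets ([small_eq_mod_segments]). *)
Definition small A : Prop := forall M : R, exists2 l : seq (aff R),
  all (@nondeg R) l &
  forall x, A x -> `|x.1| <= M -> `|x.2| <= M -> has (fun c => ev c x == 0) l.

Lemma small_sub A B : A `<=` B -> small B -> small A.
Proof.
by move=> sAB sB M; have [l nl h] := sB M; exists l => // x /sAB Bx; exact: h.
Qed.

Lemma small0 : small set0.
Proof. by move=> M; exists [::]. Qed.

Lemma smallU A B : small A -> small B -> small (A `|` B).
Proof.
move=> sA sB M; have [l nl h] := sA M; have [l' nl' h'] := sB M.
exists (l ++ l'); first by rewrite all_cat nl.
move=> x [/h hx|/h' hx] x1 x2; rewrite has_cat hx ?orbT //.
Qed.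

Lemma small_bigcup (F : nat -> set plane) n :
  (forall i, (i < n)%N -> small (F i)) ->
  small [set x | exists2 i, (i < n)%N & F i x].
Proof.
elim: n => [|n IH] h.
  by apply: (small_sub _ small0) => x [i].
apply: (@small_sub _ ([set x | exists2 i, (i < n)%N & F i x] `|` F n)).
  move=> x [i]; rewrite ltnS leq_eqVlt => /orP[/eqP -> Fx|ni Fx]; first by right.
  by left; exists i.
by apply: smallU; [apply: IH => i ni; apply: h; rewrite ltnS ltnW|apply: h].
Qed.

Lemma small_line c : nondeg c -> small [set x | ev c x = 0].
Proof.
by move=> nc M; exists [:: c]; rewrite /= ?nc // => x -> _ _; rewrite eqxx.
Qed.

(** The bound serves twice, to cut [A] and to cover it. After the cut, [small_periodize] has only
    finitely many translates to deal with. *)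
Lemma small_local A :
  (forall M, small [set x | [/\ A x, `|x.1| <= M & `|x.2| <= M]]) -> small A.
Proof.
by move=> h M; have [l nl hl] := h M M; exists l => // x Ax x1 x2; apply: hl.
Qed.

Lemma small_diag (p q : plane) A : q.1 != 0 -> q.2 != 0 -> small A ->
  small (diag p q @^-1` A).
Proof.
move=> q1 q2 sA M.
(* A crude bound for both coordinates of the image of the square of radius [M]. *)
have [l nl h] := sA (`|p.1| + `|p.2| + (`|q.1| + `|q.2|) * M).
exists [seq (c.1.1 * q.1, c.1.2 * q.2,
  c.2 + (c.1.1 * p.1 + c.1.2 * p.2)) | c <- l].
  rewrite all_map; apply: sub_all nl => c; rewrite /nondeg /=.
  by rewrite !mulf_eq0 (negPf q1) (negPf q2) !orbF.
move=> x /= /h hx x1 x2.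
have M0 : 0 <= M by apply: le_trans x1.
rewrite has_map; apply: sub_has (hx _ _).
- by move=> c /=; rewrite /ev /diag /= => /eqP <-; apply/eqP; ring.
- have := ler_normD p.1 (q.1 * x.1); rewrite normrM.
  have := ler_wpM2l (normr_ge0 q.1) x1.
  have := normr_ge0 p.2; have := mulr_ge0 (normr_ge0 q.2) M0.
  by rewrite /diag /=; lra.
- have := ler_normD p.2 (q.2 * x.2); rewrite normrM.
  have := ler_wpM2l (normr_ge0 q.2) x2.
  have := normr_ge0 p.1; have := mulr_ge0 (normr_ge0 q.1) M0.
  by rewrite /diag /=; lra.
Qed.

Lemma small_shift (d : plane) A : small A ->
  small [set x | A (x.1 + d.1, x.2 + d.2)].
Proof.
move=> /(@small_diag d (1, 1) _ (oner_neq0 _) (oner_neq0 _)); apply: small_sub.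
by move=> x; rewrite /= /diag !mul1r [d.1 + _]addrC [d.2 + _]addrC.
Qed.

(** [ev c] is Lipschitz, with constant the sum of the absolute values of its linear coefficients;
    the added 1 makes the divisor positive. *)
Lemma ev_near c x : 0 < ev c x ->
  exists2 e, 0 < e & forall y, near_pt x e y -> 0 < ev c y.
Proof.
move=> h; have k0 : 0 < `|c.1.1| + `|c.1.2| + 1.
  by have := normr_ge0 c.1.1; have := normr_ge0 c.1.2; lra.
exists (ev c x / (`|c.1.1| + `|c.1.2| + 1)); first exact: divr_gt0.
move=> y [h1 h2]; set e := ev c x / _ in h1 h2.
have ee : ev c x = e * (`|c.1.1| + `|c.1.2| + 1) by rewrite /e divfK ?gt_eqF.
have -> : ev c y = ev c x + (c.1.1 * (y.1 - x.1) + c.1.2 * (y.2 - x.2)).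
  by rewrite /ev; ring.
have e0 : 0 < e by apply: divr_gt0.
have := ler_norm (- (c.1.1 * (y.1 - x.1))).
have := ler_norm (- (c.1.2 * (y.2 - x.2))).
rewrite !normrN !normrM.
have := ler_wpM2l (normr_ge0 c.1.1) (ltW h1).
have := ler_wpM2l (normr_ge0 c.1.2) (ltW h2).
by move: ee e0; lra.
Qed.

Lemma ev_neq0_near c x : ev c x != 0 ->
  exists2 e, 0 < e & forall y, near_pt x e y ->
    (ev c y != 0) && ((0 < ev c y) == (0 < ev c x)).
Proof.
have evN : forall z, ev (- c.1.1, - c.1.2, - c.2) z = - ev c z.
  by move=> z; rewrite /ev /=; ring.
rewrite neq_lt => /orP[h|h].
  have [|e e0 he] := @ev_near (- c.1.1, - c.1.2, - c.2) x.
    by rewrite evN oppr_gt0.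
  exists e => // y /he; rewrite evN oppr_gt0 => hy.
  by rewrite (lt_eqF hy) (lt_gtF hy) (lt_gtF h).
have [e e0 he] := ev_near h; exists e => // y /he hy.
by rewrite (gt_eqF hy) hy h.
Qed.

Lemma near_pt_min (P Q : plane -> Prop) x :
  (exists2 e, 0 < e & forall y, near_pt x e y -> P y) ->
  (exists2 e, 0 < e & forall y, near_pt x e y -> Q y) ->
  exists2 e, 0 < e & forall y, near_pt x e y -> P y /\ Q y.
Proof.
move=> [e e0 h] [e' e0' h']; exists (Num.min e e'); first by rewrite lt_min e0.
move=> y hy; split; [apply: h|apply: h']; apply: near_pt_le hy.
  by rewrite ge_min lexx.
by rewrite ge_min lexx orbT.
Qed.

(** Leave the first line by a half step along an axis not parallel to it; a smaller square around
    the new point misses that line and leaves room for the others. *)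
Lemma avoid_lines (l : seq (aff R)) x e : all (@nondeg R) l -> 0 < e ->
  exists2 y, near_pt x e y & all (fun c => ev c y != 0) l.
Proof.
elim: l x e => [|c l IH] x e /=; first by exists x => //; apply: near_pt_refl.
move=> /andP[nc nl] e0.
have [y hy cy] : exists2 y, near_pt x e y & ev c y != 0.
  have [z0|nz] := eqVneq (ev c x) 0; last by exists x => //; apply: near_pt_refl.
  have h2 : 0 < e / 2 by lra.
  have a2 : `|e / 2| < e by rewrite gtr0_norm //; lra.
  case/orP: nc => nc; [exists (x.1 + e / 2, x.2)|exists (x.1, x.2 + e / 2)].
  - by split; rewrite /= ?subrr ?normr0 // [x.1 + _]addrC addrK.
  - have -> : ev c (x.1 + e / 2, x.2) = c.1.1 * (e / 2).
      by rewrite -[RHS]addr0 -z0 /ev /=; ring.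
    by rewrite mulf_neq0 // gt_eqF.
  - by split; rewrite /= ?subrr ?normr0 // [x.2 + _]addrC addrK.
  - have -> : ev c (x.1, x.2 + e / 2) = c.1.2 * (e / 2).
      by rewrite -[RHS]addr0 -z0 /ev /=; ring.
    by rewrite mulf_neq0 // gt_eqF.
have [e' e0' he'] : exists2 e', 0 < e' &
    forall z, near_pt y e' z -> near_pt x e z /\ ev c z != 0.
  apply: near_pt_min; first exact: near_pt_ball.
  by have [e' e0' h] := ev_neq0_near cy; exists e' => // z /h /andP[].
have [z /he' [z1 z2] z3] := IH y e' nl e0'.
by exists z => //; rewrite z2.
Qed.

Lemma near_norm x y : near_pt x 1 y ->
  `|y.1| <= `|x.1| + `|x.2| + 1 /\ `|y.2| <= `|x.1| + `|x.2| + 1.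
Proof.
move=> [h1 h2]; have := normr_ge0 x.1; have := normr_ge0 x.2.
have := ler_normD (y.1 - x.1) x.1; have := ler_normD (y.2 - x.2) x.2.
by rewrite !subrK => *; split; lra.
Qed.

Lemma small_dense A x e : small A -> 0 < e -> exists2 y, near_pt x e y & ~ A y.
Proof.
move=> sA e0; have [l nl h] := sA (`|x.1| + `|x.2| + 1).
(* The cap at 1 keeps the perturbed point in the square where [l] covers [A]. *)
have e1 : 0 < Num.min e 1 by rewrite lt_min e0 ltr01.
have [y hy /allP ly] := avoid_lines x nl e1.
exists y; first by apply: near_pt_le hy; rewrite ge_min lexx.
have [y1 y2] : `|y.1| <= `|x.1| + `|x.2| + 1 /\ `|y.2| <= `|x.1| + `|x.2| + 1.
  by apply: near_norm; apply: near_pt_le hy; rewrite ge_min lexx orbT.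
move=> /h /(_ y1 y2) /hasP[c lc]; exact/negP/ly.
Qed.

(** A finite union of lines is closed, so the lines that cover [A] in a slightly larger square also
    cover its closure. *)
Lemma small_adherent A : small A ->
  small [set x | forall e, 0 < e -> exists2 y, near_pt x e y & A y].
Proof.
move=> sA M; have [l nl h] := sA (M + 1); exists l => // x /= hx x1 x2.
apply/negPn/negP; rewrite -all_predC => off.
have [e e0 he] : exists2 e, 0 < e & forall y, near_pt x e y ->
    `|y.1| <= M + 1 /\ `|y.2| <= M + 1 /\ all (fun c => ev c y != 0) l.
  have H1 : exists2 e, 0 < e & forall y, near_pt x e y ->
      `|y.1| <= M + 1 /\ `|y.2| <= M + 1.
    exists 1 => // y [y1 y2].
    have := ler_normD (y.1 - x.1) x.1; have := ler_normD (y.2 - x.2) x.2.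
    by rewrite !subrK => *; split; lra.
  have H2 : exists2 e, 0 < e & forall y, near_pt x e y ->
      all (fun c => ev c y != 0) l.
    elim: (l) off => [|c l' IH] /=; first by exists 1.
    move=> /andP[cx /IH hl'].
    have [|e e0 he] := @near_pt_min (fun y => ev c y != 0) _ x _ hl'.
      by have [e e0 he] := ev_neq0_near cx; exists e => // y /he /andP[].
    by exists e => // y /he [-> ->].
  by have [e e0 he] := near_pt_min H1 H2; exists e => // y /he [[? ?] ?].
have [y /he [y1 [y2 /allP y3]] Ay] := hx e e0.
by have /hasP[c /y3 /negP] := h y Ay y1 y2.
Qed.

Lemma regular_near (A : Type) (T : tree A) x : tregular T x ->
  exists2 e, 0 < e & forall y, near_pt x e y ->
    tregular T y /\ teval T y = teval T x.
Proof.
elim: T => [a|c T1 IH1 T2 IH2] /=; first by exists 1.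
move=> /andP[/ev_neq0_near H hr].
have /(near_pt_min H) [e e0 he] : exists2 e, 0 < e & forall y, near_pt x e y ->
    (if 0 < zev c x then tregular T1 y else tregular T2 y) /\
    (if 0 < zev c x then teval T1 y else teval T2 y) =
    (if 0 < zev c x then teval T1 x else teval T2 x).
  by case: ifP hr => _; [apply: IH1|apply: IH2].
exists e => // y /he [/andP[cy /eqP cxy] [h1 h2]].
by rewrite /zev cy cxy h2; split=> //; rewrite -/(zev c x) h1.
Qed.

Lemma small_irregular (A : Type) (T : tree A) :
  wf T -> small [set x | ~~ tregular T x].
Proof.
elim: T => [a|c T1 IH1 T2 IH2] /=; first by move=> _; apply: (small_sub _ small0).
move=> /and3P[/(@znormal_nondeg R) nc /IH1 s1 /IH2 s2].
apply: (small_sub _ (smallU (small_line nc) (smallU s1 s2))).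
move=> x /=; rewrite negb_and negbK => /orP[/eqP|]; first by left.
by case: ifP => _ h; right; [left|right].
Qed.

End Small.

(** * Lattices and described partitions *)

Section Lattice.
Variable R : realType.
Local Notation plane := (R * R)%type.
Implicit Types (A B : set plane) (x y z v : plane).

(** A triangular basis covers [Gamma0] and the rectangular lattices alike. The box of sides [al] and
    [be] is a fundamental domain: reduce the second coordinate, then the first. *)
Definition lat (al ga be : R) : plane * plane := ((al, 0), (ga, be)).

Definition lattice_invariant (L : plane * plane) A : Prop :=
  forall x v, lattice L v -> A x -> A (x + v).

Lemma gap (r c : R) (k : int) : 0 < r < c -> 0 < r + k%:~R * c < c -> k = 0.
Proof.
move=> /andP[r0 rc] /andP[h1 h2]; have c0 : 0 < c by lra.
have [k0|k0|//] := ltgtP k 0.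
- have : k%:~R <= -1 :> R by rewrite -[-1](mulrNz 1 1) ler_int; lia.
  by move=> /(ler_wpM2r (ltW c0)) h; exfalso; lra.
- have : 1 <= k%:~R :> R by rewrite -[1](mulr1z 1) ler_int; lia.
  by move=> /(ler_wpM2r (ltW c0)) h; exfalso; lra.
Qed.

Lemma gap_neq (r c : R) (k : int) : 0 < r < c -> r + k%:~R * c != 0.
Proof.
move=> /andP[r0 rc]; have c0 : 0 < c by lra.
have [k0|k0] := ltP k 0.
- have : k%:~R <= -1 :> R by rewrite -[-1](mulrNz 1 1) ler_int; lia.
  by move=> /(ler_wpM2r (ltW c0)) h; rewrite lt_eqF //; lra.
- have : 0 <= k%:~R :> R by rewrite ler0z.
  by move=> /(ler_wpM2r (ltW c0)) h; rewrite gt_eqF //; lra.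
Qed.

Lemma floor_mul (y c : R) : 0 < c ->
  exists n : int, 0 <= y - n%:~R * c < c.
Proof.
move=> c0; exists (Num.floor (y / c)).
have := ge_floor (y / c); have := lt_succ_floor (y / c).
rewrite intrD ltr_pdivrMr // ler_pdivlMr // => h1 h2.
by move: h1 h2; lra.
Qed.

Lemma int_shift (m : int) (N : nat) : (`|m| <= N)%N ->
  exists2 i, (i < N.*2.+1)%N & m = i%:Z - N%:Z.
Proof. by move=> h; exists (absz (m + N%:Z)); lia. Qed.

Section Basis.
Variables al ga be : R.
Hypotheses (al0 : 0 < al) (be0 : 0 < be).
Local Notation L := (lat al ga be).

Lemma latticeP v : lattice L v <->
  exists m n : int, v = (m%:~R * al + n%:~R * ga, n%:~R * be).
Proof.
by split=> -[m [n ->]]; exists m, n; rewrite /= mulr0 add0r.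
Qed.

Lemma lattice0 : lattice L 0.
Proof. by apply/latticeP; exists 0, 0; rewrite !mul0r addr0. Qed.

Lemma latticeN v : lattice L v -> lattice L (- v).
Proof.
move=> /latticeP[m [n ->]]; apply/latticeP; exists (- m), (- n).
by congr pair; rewrite !rmorphN /= !mulNr ?opprD.
Qed.

Lemma latticeD v w : lattice L v -> lattice L w -> lattice L (v + w).
Proof.
move=> /latticeP[m [n ->]] /latticeP[m' [n' ->]]; apply/latticeP.
by exists (m + m'), (n + n'); congr pair; rewrite !rmorphD /=; ring.
Qed.

Lemma latticeB v w : lattice L v -> lattice L w -> lattice L (v - w).
Proof. by move=> hv /latticeN; apply: latticeD. Qed.

Lemma periodize_invariant A : lattice_invariant L (periodize L A).
Proof.
move=> x v hv [w hw Aw]; exists (w + v); first exact: latticeD.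
rewrite /=; have E (r s t : R) : r + t - (s + t) = r - s by ring.
by rewrite !E.
Qed.

Lemma invariantE A x v : lattice_invariant L A -> lattice L v -> A (x + v) <-> A x.
Proof.
move=> hA hv; split; last exact: hA.
by move=> /(hA _ _ (latticeN hv)); rewrite addrK.
Qed.

Lemma box_unique x v w : lattice L v -> lattice L w ->
  box al be (x - v) -> box al be (x - w) -> v = w.
Proof.
move=> hv hw [h1 h2] [h3 h4]; apply/eqP; rewrite -subr_eq0; apply/eqP.
have /latticeP[m [n E]] := latticeB hv hw.
move: (congr1 fst E) (congr1 snd E) => /= E1 E2.
have n0 : n = 0.
  by apply: (gap h2); move: h4; rewrite /= -E2 addrA subrK.
have m0 : m = 0.
  move: E1; rewrite n0 mul0r addr0 => E1.
  by apply: (gap h1); move: h3; rewrite /= -E1 addrA subrK.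
by rewrite E m0 n0 !mul0r addr0.
Qed.

Lemma reduction x : exists2 v, lattice L v &
  0 <= (x - v).1 < al /\ 0 <= (x - v).2 < be.
Proof.
have [n hn] := floor_mul x.2 be0.
have [m hm] := floor_mul (x.1 - n%:~R * ga) al0.
exists (m%:~R * al + n%:~R * ga, n%:~R * be); first by apply/latticeP; exists m, n.
by split => //=; move: hm; rewrite opprD addrA addrAC.
Qed.

Lemma small_periodize A K :
  (forall x, A x -> `|x.1| <= K /\ `|x.2| <= K) -> small A ->
  small (periodize L A).
Proof.
move=> bA sA; apply: small_local => M.
have bound (r : R) : exists N : nat, forall m : int, `|m%:~R| <= r -> (`|m| <= N)%N.
  exists (Num.bound r) => m h; rewrite -(ler_nat R) natr_absz intr_norm.
  have r0 : 0 <= r by apply: le_trans h.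
  exact: le_trans h (ltW (archi_boundP r0)).
have [N2 hN2] := bound ((M + K) / be).
(* Multiples of the second basis vector shift the first coordinate by up to [N2] times the absolute
   value of [ga]. *)
have [N1 hN1] := bound ((M + K + N2%:R * `|ga|) / al).
pose vec i j : plane := ((i%:Z - N1%:Z)%:~R * al + (j%:Z - N2%:Z)%:~R * ga,
                 (j%:Z - N2%:Z)%:~R * be).
apply: (@small_sub _ _ [set x | exists2 i, (i < N1.*2.+1)%N &
   exists2 j, (j < N2.*2.+1)%N & A (x - vec i j)]); last first.
  apply: small_bigcup => i _; apply: small_bigcup => j _.
  exact: (small_shift (- vec i j) sA).
move=> x [[v /latticeP[m [n ->]] /= Av] x1 x2].
have [/= b1 b2] := bA _ Av.
have nN : (`|n| <= N2)%N.
  apply: hN2; rewrite ler_pdivlMr // -{1}(gtr0_norm be0) -normrM.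
  have := ler_normB x.2 (x.2 - n%:~R * be).
  by rewrite subKr; lra.
have nR : `|n%:~R| <= N2%:R :> R.
  by rewrite -intr_norm -natr_absz ler_nat.
have mN : (`|m| <= N1)%N.
  apply: hN1; rewrite ler_pdivlMr // -{1}(gtr0_norm al0) -normrM.
  have := ler_normB x.1 (x.1 - (m%:~R * al + n%:~R * ga)).
  rewrite subKr.
  have := ler_normB (m%:~R * al + n%:~R * ga) (n%:~R * ga).
  rewrite addrK [ `|n%:~R * ga|]normrM.
  by have := ler_wpM2r (normr_ge0 ga) nR; lra.
have [i iN mi] := int_shift mN; have [j jN nj] := int_shift nN.
by exists i => //; exists j => //; rewrite /vec -mi -nj.
Qed.

(** Passing from the open to the half-open box adds only parts of two lines, and the translates of
    the half-open box cover the plane. *)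
Lemma small_invariant A :
  lattice_invariant L A -> small (box al be `&` A) -> small A.
Proof.
move=> iA sA.
pose D : set plane := [set x | 0 <= x.1 < al /\ 0 <= x.2 < be].
have sD : small (D `&` A).
  have n1 : nondeg ((1, 0, 0) : aff R) by rewrite /nondeg /= oner_neq0.
  have n2 : nondeg ((0, 1, 0) : aff R) by rewrite /nondeg /= oner_neq0 orbT.
  apply: (small_sub _ (smallU sA (smallU (small_line n1) (small_line n2)))).
  move=> x [[h1 h2] Ax].
  have [z1|z1] := eqVneq x.1 0.
    by right; left; rewrite /ev /= z1 mulr0 mul0r !addr0.
  have [z2|z2] := eqVneq x.2 0.
    by right; right; rewrite /ev /= z2 mulr0 mul0r !addr0.
  by left; split=> //; split; rewrite lt_def ?z1 ?z2.
apply: (small_sub _ (@small_periodize (D `&` A) (al + be) _ sD)) => [x Ax|].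
  have [v hv hD] := reduction x; exists v => //; split => //.
  exact: (iA _ _ (latticeN hv) Ax).
by move=> x [[h1 h2] _]; rewrite !ger0_norm; lra.
Qed.

Lemma periodize_box a b A x : a <= al -> b <= be -> box al be x ->
  periodize L (A `&` box a b) x <-> A x /\ box a b x.
Proof.
move=> ale ble bx; split; last first.
  by move=> h; exists 0; [exact: lattice0|rewrite /= !subr0 -surjective_pairing].
move=> [v hv [Av [h1 h2]]].
suff v0 : v = 0.
  by move: Av h1 h2; rewrite v0 /= !subr0 -surjective_pairing.
apply: (box_unique (x := x) hv lattice0); rewrite ?subr0 //.
by split; rewrite /=; [move: h1|move: h2] => /=; lra.
Qed.

End Basis.

Lemma box_near (a b : R) x : box a b x ->
  exists2 e, 0 < e & forall y, near_pt x e y -> box a b y.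
Proof.
move=> [/andP[x1 x1a] /andP[x2 x2b]].
exists (Num.min (Num.min x.1 (a - x.1)) (Num.min x.2 (b - x.2))).
  by rewrite !lt_min x1 x2 !subr_gt0 x1a.
move=> y [h1 h2].
move: h1 h2; rewrite !lt_min !ltr_norml.
move=> /andP[/andP[h1 h2] _] /andP[_ /andP[h3 h4]].
by split; lra.
Qed.

(** * Sets that agree with a tree off a small set *)

Section Agreement.
Variables (a b : R) (X : Type) (T : tree X) (p : X -> Prop) (A : set plane).
Hypothesis wfT : wf T.
Hypothesis agree : small [set x | box a b x /\ ~ (A x <-> p (teval T x))].

(** Near a regular point that is not adherent to the set of disagreement, [A] coincides with a
    locally constant predicate. *)
Lemma agree_lconst : small [set x | box a b x /\ ~ lconst A x].
Proof.
apply: (small_sub _ (smallU (small_adherent agree) (@small_irregular R _ _ wfT))).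
move=> x [bx nl]; have [rx|nrx] := boolP (tregular T x); last by right.
left=> e e0; apply/not_exists2P => h; apply: nl.
have H0 : exists2 e, 0 < e & forall y, near_pt x e y ->
    (A y <-> p (teval T y)).
  have [e' e'0 he'] : exists2 e', 0 < e' & forall y, near_pt x e' y ->
      near_pt x e y /\ box a b y.
    by apply: near_pt_min; [exists e|exact: box_near].
  exists e' => // y /he' [ye yb]; apply: contrapT => nA.
  by case: (h y) => //; apply; split.
have [d d0 hd] := near_pt_min H0 (regular_near rx).
exists d => // y /hd [hy [_ ey]].
by have [hx _] := hd x (near_pt_refl x d0); rewrite hy hx ey.
Qed.

Lemma agree_interior :
  small [set x | box a b x /\ ~ (A° x <-> p (teval T x))].
Proof.
apply: (small_sub _ (smallU agree agree_lconst)) => x [bx nx].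
have [lx|nl] := pselect (lconst A x); last by right.
left; split=> //; apply: contra_not nx => <-.
by split; [exact: interior_subset|move=> Ax; exact: interior_lconst].
Qed.

End Agreement.

(* The atoms of [P], cut to the fundamental domain, are the level sets of the
   function computed by [T]. *)
Record described (al ga be : R) (P : Defs.partition R) (T : tree nat) : Prop := {
  described_invariant : forall a, lattice_invariant (lat al ga be) (atom P a);
  described_wf : wf T;
  described_leaves : all (fun a => (a < size P)%N) (leaves T);
  described_agree : forall a, (a < size P)%N ->
    small [set x | box al be x /\ ~ (atom P a x <-> teval T x = a)] }.

(** * Small sets and finite families of segments *)

Lemma small_segment (e : plane * plane) : small (segment e.1 e.2).
Proof.
case: e => p q /=.
have [E|ne] := eqVneq p q.
  have n1 : nondeg ((1, 0, - p.1) : aff R) by rewrite /nondeg /= oner_neq0.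
  apply: (small_sub _ (small_line n1)) => x [k _ ->].
  by rewrite -E /ev /=; ring.
pose c : aff R := (q.2 - p.2, - (q.1 - p.1),
   - ((q.2 - p.2) * p.1 - (q.1 - p.1) * p.2)).
have nc : nondeg c.
  rewrite /nondeg /= oppr_eq0 !subr_eq0; apply: contraR ne.
  rewrite negb_or !negbK => /andP[/eqP h1 /eqP h2].
  by rewrite [p]surjective_pairing [q]surjective_pairing h1 h2.
apply: (small_sub _ (small_line nc)) => x [k _ ->].
by rewrite /ev /c /=; ring.
Qed.

Lemma segment_bound (p q x : plane) : segment p q x ->
  `|x.1| <= `|p.1| + `|q.1| /\ `|x.2| <= `|p.2| + `|q.2|.
Proof.
move=> [k /andP[k0 k1] ->] /=.
have B (u v : R) : `|(1 - k) * u + k * v| <= `|u| + `|v|.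
  apply: le_trans (ler_normD _ _) _; rewrite !normrM.
  rewrite [ `|1 - k|]ger0_norm ?subr_ge0 // [ `|k|]ger0_norm //.
  by apply: lerD; rewrite -[leRHS]mul1r ler_wpM2r // lerBlDr lerDl.
by split.
Qed.

Lemma small_segments (l : seq (plane * plane)) :
  small (\big[setU/set0]_(e <- l) segment e.1 e.2) /\
  exists K, forall x, (\big[setU/set0]_(e <- l) segment e.1 e.2) x ->
    `|x.1| <= K /\ `|x.2| <= K.
Proof.
elim: l => [|e l [sl [K hK]]].
  by rewrite big_nil; split; [exact: small0|exists 0].
rewrite big_cons; split; first by apply: smallU => //; exact: small_segment.
exists (Num.max K 0 + `|e.1.1| + `|e.2.1| + `|e.1.2| + `|e.2.2|) => x.
have := normr_ge0 e.1.1; have := normr_ge0 e.2.1.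
have := normr_ge0 e.1.2; have := normr_ge0 e.2.2.
have : 0 <= Num.max K 0 by rewrite le_max lexx orbT.
have : K <= Num.max K 0 by rewrite le_max lexx.
move=> h1 h2 h3 h4 h5 h6 [/segment_bound[]|/hK[]] h7 h8.
  by split; lra.
by split; lra.
Qed.

Lemma eq_mod_segments_small al be A B : 0 < al -> 0 < be ->
  eq_mod_segments (rectangular al be) A B -> small ((A `\` B) `|` (B `\` A)).
Proof.
move=> al0 be0 [l /small_sub]; apply.
have [sl [K hK]] := small_segments l.
exact: (@small_periodize al 0 be al0 be0 _ K).
Qed.

(** The segment parameter is the first coordinate, or the second one on a vertical line, rescaled
    from [-M, M] to [0, 1]. *)
Lemma line_segment (c : aff R) M : nondeg c ->
  exists e : plane * plane, forall x, ev c x = 0 ->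
    `|x.1| <= M -> `|x.2| <= M -> segment e.1 e.2 x.
Proof.
move=> nc.
have [M0|M0] := leP M 0.
  exists (0, 0) => x _ x1 x2; exists 0; first by rewrite lexx ler01.
  have /eqP : x.1 = 0 by apply/eqP; rewrite -normr_le0; lra.
  have /eqP : x.2 = 0 by apply/eqP; rewrite -normr_le0; lra.
  move=> /eqP E2 /eqP E1.
  by rewrite [LHS]surjective_pairing E1 E2 /= !mulr0 addr0.
have k01 (r : R) : `|r| <= M -> 0 <= (r + M) / (2 * M) <= 1.
  rewrite ler_norml => /andP[h1 h2]; apply/andP; split.
    by apply: divr_ge0; lra.
  by rewrite ler_pdivrMr; lra.
have [b0|b0] := eqVneq c.1.2 0.
  have a0 : c.1.1 != 0 by move: nc; rewrite /nondeg b0 eqxx orbF.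
  exists ((- c.2 / c.1.1, - M), (- c.2 / c.1.1, M)) => x ex x1 x2.
  exists ((x.2 + M) / (2 * M)); first exact: k01.
  have E : x.1 = - c.2 / c.1.1.
    move: ex; rewrite /ev b0 mul0r addr0 => ex.
    by rewrite (_ : - c.2 = c.1.1 * x.1) ?[_ * x.1]mulrC ?mulfK //; lra.
  rewrite [LHS]surjective_pairing E /=; congr pair; field.
    by rewrite a0 gt_eqF.
  by rewrite gt_eqF.
pose Y r := - (c.1.1 * r + c.2) / c.1.2.
exists ((- M, Y (- M)), (M, Y M)) => x ex x1 x2.
exists ((x.1 + M) / (2 * M)); first exact: k01.
have E : x.2 = Y x.1.
  rewrite /Y (_ : - (c.1.1 * x.1 + c.2) = c.1.2 * x.2); last first.
    by move: ex; rewrite /ev; lra.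
  by rewrite [_ * x.2]mulrC mulfK.
rewrite [LHS]surjective_pairing E /= /Y; congr pair; field.
  by rewrite gt_eqF.
by rewrite b0 gt_eqF.
Qed.

(** The square of radius [al + be] contains a fundamental domain, so finitely many clipped lines
    cover the difference there, and invariance does the rest. *)
Lemma small_eq_mod_segments al be A B : 0 < al -> 0 < be ->
  lattice_invariant (rectangular al be) A ->
  lattice_invariant (rectangular al be) B ->
  small ((A `\` B) `|` (B `\` A)) -> eq_mod_segments (rectangular al be) A B.
Proof.
move=> al0 be0 iA iB sD; have [l nl h] := sD (al + be).
have [f hf] : exists f : aff R -> plane * plane, forall c, nondeg c ->
    forall x, ev c x = 0 -> `|x.1| <= al + be -> `|x.2| <= al + be ->
    segment (f c).1 (f c).2 x.
  suff : forall c, exists e : plane * plane, nondeg c -> forall x, ev c x = 0 ->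
      `|x.1| <= al + be -> `|x.2| <= al + be -> segment e.1 e.2 x.
    by move=> /choice[f hf]; exists f.
  move=> c; have [nc|nnc] := boolP (nondeg c); last by exists (0, 0).
  by have [e he] := line_segment (al + be) nc; exists e.
exists (map f l) => x xD.
have [v hv [h1 h2]] := @reduction al 0 be al0 be0 x.
have n1 : `|(x - v).1| <= al + be by rewrite ger0_norm; lra.
have n2 : `|(x - v).2| <= al + be by rewrite ger0_norm; lra.
exists v => //.
have vN := latticeN hv.
have : ((A `\` B) `|` (B `\` A)) (x - v).
  by case: xD => -[h3 h4]; [left|right]; split;
    rewrite ?(@invariantE al 0 be) // => h5; apply: h4;
    move: h5; rewrite (@invariantE al 0 be).
move=> /h /(_ n1 n2) /hasP[c lc /eqP ec].
rewrite big_map -bigcup_seq; exists c => //.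
exact: hf (allP nl _ lc) _ ec n1 n2.
Qed.

End Lattice.

(** * Induction *)

Definition zvec := (zphi * zphi)%type.
Definition vadd (v w : zvec) : zvec := (zadd v.1 w.1, zadd v.2 w.2).
Definition vsub (v w : zvec) : zvec := (zsub v.1 w.1, zsub v.2 w.2).

Definition box_tree (a b : zphi) : tree bool := conj_tree (box_forms a b).

Definition lattice_vec (al ga be : zphi) (p : Z * Z) : zvec :=
  (zadd (zmul (zz p.1) al) (zmul (zz p.2) ga), zmul (zz p.2) be).

(** A step of the rotation never goes beyond the adjacent translates; otherwise [reduce] would fall
    back on its default [None], which [stage_check] rejects. *)
Definition neighbours (al ga be : zphi) : seq zvec :=
  let r : seq Z := [:: 0; 1; -1] in
  [seq lattice_vec al ga be (m, n) | n <- r, m <- r].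

(* Continues with the translate of [x + d] by minus an element of [vs] that lies
   in the fundamental domain, if there is one. *)
Fixpoint reduce (B : eqType) (al be : zphi) (vs : seq zvec) (dflt : tree B)
    (cs : seq zaff) (d : zvec) (k : seq zaff -> zvec -> tree B) : tree B :=
  match vs with
  | [::] => dflt
  | v :: vs' =>
    explore cs (tshift (vsub d v) (box_tree al be)) (fun cs' inside =>
      if inside then k cs' (vsub d v) else reduce al be vs' dflt cs' d k)
  end.

(* The tree of the return word to the box [(0, a) x (0, b)], where [d] is the
   displacement from [x] to the reduced current point of its orbit, and [acc]
   the word read so far. *)
Fixpoint run (n : nat) (al ga be a b : zphi) (st : zvec) (T : tree nat)
    (cs : seq zaff) (d : zvec) (acc : seq nat) : tree (option (seq nat)) :=
  if n is n'.+1 then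
    explore cs (tshift d T) (fun cs' l =>
      reduce al be (neighbours al ga be) (Leaf None) cs' (vadd d st)
        (fun cs' d' =>
          explore cs' (tshift d' (box_tree a b)) (fun cs' returned =>
            if returned then Leaf (Some (rcons acc l))
            else run n' al ga be a b st T cs' d' (rcons acc l))))
  else Leaf None.

Lemma reduce_cons (B : eqType) al be v vs (dflt : tree B) cs d k :
  reduce al be (v :: vs) dflt cs d k =
  explore cs (tshift (vsub d v) (box_tree al be)) (fun cs' inside =>
    if inside then k cs' (vsub d v) else reduce al be vs dflt cs' d k).
Proof. by []. Qed.

Lemma runS n al ga be a b st T cs d acc :
  run n.+1 al ga be a b st T cs d acc =
  explore cs (tshift d T) (fun cs' l =>
    reduce al be (neighbours al ga be) (Leaf None) cs' (vadd d st)
      (fun cs' d' =>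
        explore cs' (tshift d' (box_tree a b)) (fun cs' returned =>
          if returned then Leaf (Some (rcons acc l))
          else run n al ga be a b st T cs' d' (rcons acc l)))).
Proof. by []. Qed.

Definition return_tree (n : nat) (al ga be a b : zphi) (st : zvec) (T : tree nat)
    : tree (option (seq nat)) :=
  run n al ga be a b st T (box_forms a b) (zz 0, zz 0) [::].

Definition index_tree (ws : seq (seq nat)) (U : tree (option (seq nat))) : tree nat :=
  tmap (fun o => index (odflt [::] o) ws) U.

(** Evaluates at [(x / n, y / n)] in homogeneous coordinates, so that no division leaves Z[phi]. A
    vanishing form gives [None], since the point has to be regular. *)
Fixpoint sample (A : Type) (T : tree A) (x y n : zphi) : option A :=
  match T with
  | Leaf a => Some a
  | Node c T1 T2 =>
    let v := zadd (zadd (zmul c.1.1 x) (zmul c.1.2 y)) (zmul c.2 n) in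
    if zpos v then sample T1 x y n
    else if zpos (zopp v) then sample T2 x y n else None
  end.

(* Since [T] is locally constant off its lines, the level set of [l] in the box
   has nonempty interior when [T] takes the value [l] at a point of the grid
   where no node vanishes. *)
Definition sampled (A : eqType) (a b : zphi) (N : nat) (T : tree A) (l : A) : bool :=
  lazy_has (fun i => lazy_has (fun j =>
      let x := zmul (zz (Z.of_nat i)) a in
      let y := zmul (zz (Z.of_nat j)) b in
      let n := zz (Z.of_nat N) in
      (sample (box_tree a b) x y n == Some true) && (sample T x y n == Some l))
    (iota 1 N)) (iota 1 N).

(** The test on leaves shows that no word outside [ws] occurs, sampling that each word of [ws] does;
    [uniq] and [sorted] fix their order. The bound on sizes tells how many orbit points have to be
    generic. *)
Definition stage_check (n N : nat) (al ga be a b : zphi) (st : zvec)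
    (T : tree nat) (ws : seq (seq nat)) : bool :=
  let U := return_tree n al ga be a b st T in
  [&& [&& zpos al, zpos be, zpos a & zpos b],
    znonneg (zsub al a) && znonneg (zsub be b),
    wf U, all (mem (map Some ws)) (leaves U), all (fun w => size w <= n)%N ws,
    uniq ws, sorted radix ws
    & all (sampled a b N U) (map Some ws)].

(** Together with antisymmetry and totality, this makes a sorted list depend only on its
    elements. *)
Lemma radix_trans : transitive radix.
Proof.
move=> v u w; rewrite /radix => /orP[h1|/andP[/eqP e1 h1]];
  move=> /orP[h2|/andP[/eqP e2 h2]].
- by rewrite (ltn_trans h1).
- by rewrite -e2 h1.
- by rewrite e1 h2.
- by rewrite e1 e2 ltnn eqxx /=; apply: le_trans h2.
Qed.

Lemma radix_anti : antisymmetric radix.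
Proof.
move=> u v; rewrite /radix; case: (ltngtP (size u) (size v)) => //= _.
by move=> h; apply/(@le_anti _ (seqlexi nat)).
Qed.

Lemma radix_total : total radix.
Proof.
move=> u v; rewrite /radix; case: (ltngtP (size u) (size v)) => //= _.
exact: (@le_total _ (seqlexi nat)).
Qed.

Section Stage.
Variable R : realType.
Local Notation plane := (R * R)%type.
Local Notation zval := (@zval R).
Local Notation vval := (@vval R).

Lemma vvalD v w : vval (vadd v w) = vval v + vval w.
Proof. by rewrite /vval /= !zvalD. Qed.

Lemma vvalB v w : vval (vsub v w) = vval v - vval w.
Proof. by rewrite /vval /= !zvalB. Qed.

Lemma sample_sound (A : Type) (T : tree A) x y n a : 0 < zval n ->
  sample T x y n = Some a ->
  let p := (zval x / zval n, zval y / zval n) in tregular T p /\ teval T p = a.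
Proof.
move=> n0 /=; elim: T => [b [->]|c T1 IH1 T2 IH2] //=.
set p := (_, _) in IH1 IH2 *; set v := zadd _ _.
have E : zval v = zval n * zev c p.
  by rewrite !zvalE /zev /ev /=; field; rewrite gt_eqF.
case: ifP => [/(@zpos_gt0 R)|_].
  by rewrite E (pmulr_rgt0 _ n0) => h; rewrite h gt_eqF.
case: ifP => [/(@zpos_gt0 R)|//].
rewrite zvalN E oppr_gt0 (pmulr_rlt0 _ n0) => h.
by rewrite lt_eqF // lt_gtF.
Qed.

Lemma sampled_sound (A : eqType) a b N (T : tree A) l :
  0 < zval a -> 0 < zval b -> sampled a b N T l ->
  exists p, [/\ box (zval a) (zval b) p, tregular T p & teval T p = l].
Proof.
rewrite /sampled lazy_hasE => a0 b0 /hasP[i iN].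
rewrite lazy_hasE => /hasP[j jN /andP[/eqP h1 /eqP h2]].
have n0 : 0 < zval (zz (Z.of_nat N)).
  rewrite zval_zz ltr0z; move: iN; rewrite mem_iota; lia.
have [_ /eqP h3] := sample_sound n0 h1; have [h4 h5] := sample_sound n0 h2.
exists (zval (zmul (zz (Z.of_nat i)) a) / zval (zz (Z.of_nat N)),
        zval (zmul (zz (Z.of_nat j)) b) / zval (zz (Z.of_nat N))); split => //.
by apply/sat_box; move: h3; rewrite teval_conj => /eqP.
Qed.

(** * Soundness of the symbolic orbit *)

Section Walk.
Variables (al ga be a b : zphi) (st : zvec) (T : tree nat).
Variables (P : Defs.partition R) (act : action R) (i : direction).
Hypotheses (al0 : 0 < zval al) (be0 : 0 < zval be).
Hypotheses (ale : zval a <= zval al) (ble : zval b <= zval be).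
Hypothesis actE : forall k x, act (unit_step i k) x = x + vval st *+ k.
Local Notation L := (lat (zval al) (zval ga) (zval be)).
Local Notation W := (periodize L (box (zval a) (zval b))).
Hypothesis PT : described (zval al) (zval ga) (zval be) P T.

Let atom_invariant l : lattice_invariant L (atom P l).
Proof. exact: described_invariant PT _. Qed.

Let orb k x := act (unit_step i k) x.

(** Generic points of the fundamental domain, where the tree, the window test and the atoms can all
    be trusted. *)
Definition nice (z : plane) : Prop :=
  [/\ tregular T z, tregular (box_tree a b) z &
    forall l, (l < size P)%N -> lconst (atom P l) z /\ (atom P l z <-> teval T z = l)].

(** The lattice-invariant form of [nice], applicable to orbit points that are not reduced. *)
Definition tame (y : plane) : Prop := exists v,
  [/\ lattice L v, box (zval al) (zval be) (y - v) & nice (y - v)].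

Lemma wf_box_tree a' b' : wf (box_tree a' b').
Proof. by []. Qed.

Lemma small_wild : small [set y | ~ tame y].
Proof.
apply: (small_invariant al0 be0 (ga := zval ga)).
  move=> x w hw /= nt [v [hv bv nv]]; apply: nt; exists (v - w); split.
  - exact: latticeB.
  - by rewrite opprB addrA.
  - by rewrite opprB addrA.
have sP := small_bigcup (n := size P) (F := fun l => [set x |
   box (zval al) (zval be) x /\ ~ (atom P l x <-> teval T x = l)]
  `|` [set x | box (zval al) (zval be) x /\ ~ lconst (atom P l) x]).
have {}sP : small _ := sP (fun l lP => smallU (described_agree PT lP)
   (agree_lconst (p := fun k => k = l) (described_wf PT) (described_agree PT lP))).
have sT := @small_irregular R _ T (described_wf PT).
have sB := @small_irregular R _ (box_tree a b) (wf_box_tree a b).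
apply: (small_sub _ (smallU sP (smallU sT sB))) => x [bx nt].
apply: contrapT => h; apply: nt; exists 0; rewrite subr0.
split => //; first exact: lattice0.
split; [by apply: contrapT => /negP hr; apply: h; right; left| |].
  by apply: contrapT => /negP hr; apply: h; right; right.
move=> l lP; split; apply: contrapT => hr; apply: h; left; exists l => //.
  by right.
by left.
Qed.

(** A form of the box vanishes at a translate only if a coordinate is a multiple of the period,
    which the existence of a translate in the open box excludes. *)
Lemma tame_box_tree y v : tame y -> lattice L v ->
  tregular (box_tree al be) (y - v).
Proof.
move=> [w [hw [b1 b2] _]] hv.
have /latticeP[m [n E]] := latticeB hw hv.
have -> : y - v = (y - w) + (w - v) by rewrite addrA subrK.
rewrite E; move: (y - w) b1 b2 => z b1 b2.
rewrite /box_tree /conj_tree /= /zev /ev /= !(zval0, zval1, zvalN1) !mul0r !mul1r.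
rewrite !add0r !addr0 !mulN1r.
have nB : z.2 + n%:~R * zval be != 0 by apply: gap_neq.
rewrite nB /=; case: ifP => // n0.
have E2 (c r : R) (k : int) : - (c + k%:~R * r) + r = - (c + (k - 1)%:~R * r).
  by rewrite rmorphB /=; ring.
rewrite E2 oppr_eq0 gap_neq //=; case: ifP => // n1.
(* Past both tests on the second coordinate, the two translates have the same one, and the shear
   [ga] disappears. *)
have -> : n = 0.
  apply: (gap b2); rewrite n0 /=; move: n1; rewrite -E2; lra.
by rewrite mul0r addr0 gap_neq //= E2 oppr_eq0 gap_neq //= !if_same.
Qed.

Lemma tame_nice y v : tame y -> lattice L v ->
  box (zval al) (zval be) (y - v) -> nice (y - v).
Proof.
move=> [w [hw bw nw]] hv bv.
by rewrite (box_unique hv hw bv bw).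
Qed.

Lemma lconst_shift (A : set plane) y v : lattice_invariant L A -> lattice L v ->
  lconst A (y - v) -> lconst A y.
Proof.
move=> iA hv [e e0 he]; exists e => // z [z1 z2].
have vN := latticeN hv.
have := he (z - v); rewrite !(invariantE _ iA vN); apply.
by split; rewrite /= opprB addrA subrK.
Qed.

Lemma tame_letter y v : tame y -> lattice L v ->
  box (zval al) (zval be) (y - v) ->
  (forall l, (l < size P)%N -> ~ boundary (atom P l) y) /\
  atom P (teval T (y - v)) y.
Proof.
move=> ty hv bv; have [rT _ hl] := tame_nice ty hv bv.
split=> [l lP|].
  apply/boundary_lconst; have [h _] := hl l lP.
  exact: (lconst_shift (@atom_invariant l) hv h).
have lP : (teval T (y - v)%R < size P)%N.
  exact: (allP (described_leaves PT) _ (teval_leaves _ _)).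
have [_ h] := hl _ lP.
apply/(invariantE _ (@atom_invariant _) (latticeN hv)).
exact/h.
Qed.

Lemma window_reduce y v : lattice L v -> box (zval al) (zval be) (y - v) ->
  W y <-> box (zval a) (zval b) (y - v).
Proof.
move=> hv bv; split; last by exists v.
move=> [w hw bw]; suff -> : v = w by [].
apply: (box_unique hv hw bv).
have [/andP[h1 h2] /andP[h3 h4]] : box (zval a) (zval b) (y - w) := bw.
by split; apply/andP; split => //;
  [apply: lt_le_trans h2 _|apply: lt_le_trans h4 _].
Qed.

Lemma lattice_neighbours v : v \in neighbours al ga be -> lattice L (vval v).
Proof.
move=> /allpairsP[[n m] /= [_ _ ->]]; apply/latticeP.
exists (int_of_Z m), (int_of_Z n).
by rewrite /vval /lattice_vec /= !zvalE !zval_zz.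
Qed.

Lemma reduce_sound (B : eqType) (Q : B -> Prop) x vs dflt cs d k :
  (forall v, v \in vs -> lattice L (vval v)) -> tame (x + vval d) ->
  sat cs x -> Q (teval dflt x) ->
  (forall cs' v, sat cs' x -> lattice L (vval v) ->
    box (zval al) (zval be) (x + vval d - vval v) ->
    Q (teval (k cs' (vsub d v)) x)) ->
  Q (teval (reduce al be vs dflt cs d k) x).
Proof.
move=> + td + Qd Qk; elim: vs cs => [|v vs IH] cs // hvs hcs; rewrite reduce_cons.
have hv : lattice L (vval v) by apply: hvs; rewrite inE eqxx.
have E : x + vval (vsub d v) = x + vval d - vval v.
  by rewrite -addrA -vvalB.
apply: (explore_sound (Q := Q)) => //.
  by rewrite tregular_tshift E; apply: tame_box_tree.
move=> cs' hcs'; rewrite teval_tshift E /box_tree teval_conj.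
case: ifP => [/sat_box bx|_]; first exact: Qk.
by apply: IH => // w wvs; apply: hvs; rewrite inE wvs orbT.
Qed.

Definition read_letter (x : plane) (k l : nat) : Prop :=
  (forall l', (l' < size P)%N -> ~ boundary (atom P l') (orb k x)) /\
  atom P l (orb k x).

(** Loop invariant: [x + vval d] is the reduced translate of the orbit point of rank [size acc],
    [acc] lists the letters read before it, and the orbit has not yet returned. Nothing is claimed
    for the value [None]. *)
Lemma run_sound n cs d acc x :
  (forall k, (k <= size acc + n)%N -> tame (orb k x)) -> sat cs x ->
  (exists2 v, lattice L v & x + vval d = orb (size acc) x - v) ->
  box (zval al) (zval be) (x + vval d) ->
  (forall k, (k < size acc)%N -> read_letter x k (nth 0%N acc k)) ->
  (forall k, (0 < k <= size acc)%N -> ~ W (orb k x)) ->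
  forall w, teval (run n al ga be a b st T cs d acc) x = Some w ->
  has_return_word P act W i x w.
Proof.
elim: n cs d acc => [|n IH] cs d acc // tx hcs [v hv dv] bx hacc hW.
pose Q o := forall w, o = Some w -> has_return_word P act W i x w.
have t0 := tx _ (leq_addr _ _).
rewrite dv in bx.
rewrite runS; apply: (explore_sound (Q := Q)) => //.
  by rewrite tregular_tshift dv; have [] := tame_nice t0 hv bx.
move=> cs1 hcs1.
have {hacc} hacc : forall k, (k < (size acc).+1)%N ->
    read_letter x k (nth 0%N (rcons acc (teval (tshift d T) x)) k).
  move=> k; rewrite ltnS leq_eqVlt nth_rcons => /orP[/eqP ->|kacc].
    rewrite ltnn eqxx teval_tshift dv.
    exact: tame_letter.
  by rewrite kacc; apply: hacc.
move: (teval _ x) hacc => l hacc.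
have orbS k : orb k.+1 x = orb k x + vval st by rewrite /orb !actE mulrSr addrA.
have E1 : x + vval (vadd d st) = orb (size acc).+1 x - v.
  by rewrite vvalD addrA dv orbS addrAC.
have t1 : tame (orb (size acc).+1 x) by apply: tx; rewrite addnS ltnS leq_addr.
have t1' : tame (x + vval (vadd d st)).
  move: t1 => [w [hw bw nw]]; exists (w - v); split; first exact: latticeB.
    by rewrite E1 opprB addrA subrK.
  by rewrite E1 opprB addrA subrK.
apply: (reduce_sound (Q := Q)) => //; first exact: lattice_neighbours.
move=> cs2 u hcs2 hu bu; set d' := vsub _ u.
have E2 : x + vval d' = orb (size acc).+1 x - (v + vval u).
  by rewrite vvalB addrA E1 opprD addrA.
have hvu : lattice L (v + vval u) by apply: latticeD.
have bu2 : box (zval al) (zval be) (orb (size acc).+1 x - (v + vval u)).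
  by rewrite -E2 vvalB addrA.
apply: (explore_sound (Q := Q)) => //.
  rewrite tregular_tshift E2.
  by have [] := tame_nice t1 hvu bu2.
move=> cs3 hcs3; rewrite teval_tshift /box_tree teval_conj.
have HW : sat (box_forms a b) (x + vval d') <-> W (orb (size acc).+1 x).
  apply: (iff_trans (sat_box _ _ _)); rewrite E2.
  exact: (iff_sym (window_reduce hvu bu2)).
case: ifP => [/HW Wx|/negP nW].
  move=> w [<-]; split; rewrite size_rcons //; split=> //.
apply: IH => //; rewrite ?size_rcons //.
- by move=> k; rewrite addSnnS; apply: tx.
- by exists (v + vval u).
- by rewrite E2.
- move=> k /andP[k0]; rewrite leq_eqVlt => /orP[/eqP ->|ks]; first by move/HW.
  by apply: hW; rewrite k0 -ltnS.
Qed.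


(** The return time fixes the length; at a tame point the atoms are level sets of [T], so only one
    contains it. *)
Lemma return_word_unique x w w' :
  (forall k, (k < size w)%N -> tame (orb k x)) ->
  has_return_word P act W i x w -> has_return_word P act W i x w' -> w = w'.
Proof.
move=> tx [[s0 Ws ns] hw] [[s0' Ws' ns'] hw'].
have es : size w = size w'.
  have [lt|lt|//] := ltngtP (size w) (size w').
    by case: (ns' (size w)); rewrite ?s0.
  by case: (ns (size w')); rewrite ?s0'.
apply: (@eq_from_nth _ 0%N) => // k kw.
have [v [hv _ [_ _ hl]]] := tx k kw.
have letterE l : atom P l (orb k x) -> teval T (orb k x - v) = l.
  (* An index beyond the list of atoms denotes the empty set. *)
  move=> al1; have lP : (l < size P)%N.
    by rewrite ltnNge; apply/negP => h; move: al1; rewrite /atom nth_default.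
  by apply/(hl l lP).2/(atom_invariant (latticeN hv)).
have [_ /letterE <-] := hw k kw; rewrite es in kw.
by have [_ /letterE] := hw' k kw.
Qed.

Lemma window_invariant : lattice_invariant L W.
Proof. exact: periodize_invariant. Qed.

Lemma has_return_word_invariant w :
  lattice_invariant L [set x | W x /\ has_return_word P act W i x w].
Proof.
have orbD k x v : act (unit_step i k) (x + v) = act (unit_step i k) x + v.
  by rewrite !actE addrAC.
move=> x v hv [Wx [[s0 Ws ns] hw]]; split; first exact: window_invariant.
split.
  split=> //; first by rewrite orbD; apply: window_invariant.
  by move=> k hk; rewrite orbD (invariantE _ window_invariant hv); apply: ns.
move=> k hk; rewrite orbD; have [h1 h2] := hw k hk; split.
  move=> l lP; apply/boundary_lconst.
  have /boundary_lconst h := h1 l lP.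
  by apply: (@lconst_shift _ _ v (@atom_invariant l) hv); rewrite addrK.
exact: atom_invariant.
Qed.

End Walk.

Lemma interior_invariant L (A : set plane) :
  (forall v, lattice L v -> lattice L (- v)) ->
  lattice_invariant L A -> lattice_invariant L A°.
Proof.
move=> LN iA x v hv /interior_near[e e0 he]; apply/interior_near.
exists e => // y [y1 y2]; rewrite -[y](subrK v); apply: (iA _ _ hv).
have E (r s t : R) : r - t - s = r - (s + t) by ring.
by apply: he; split; rewrite /= E.
Qed.

Lemma stage (n N : nat) (al ga be a b : zphi) (st : zvec) (T : tree nat)
    (ws : seq (seq nat)) (P : Defs.partition R) (act : action R) (i : direction) :
  stage_check n N al ga be a b st T ws ->
  (forall k x, act (unit_step i k) x = x + vval st *+ k) ->
  described (zval al) (zval ga) (zval be) P T ->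
  let L := lat (zval al) (zval ga) (zval be) in
  return_words P act (periodize L (box (zval a) (zval b))) i = ws /\
  described (zval a) 0 (zval b) (induced_partition i L P act (zval a) (zval b))
    (index_tree ws (return_tree n al ga be a b st T)).
Proof.
rewrite /stage_check; set U := return_tree _ _ _ _ _ _ _ _.
case/and5P => /and4P[/(@zpos_gt0 R) al0 /(@zpos_gt0 R) be0].
move=> /(@zpos_gt0 R) a0 /(@zpos_gt0 R) b0.
case/andP=> /(@znonneg_ge0 R) + /(@znonneg_ge0 R); rewrite !zvalB !subr_ge0.
move=> ale ble wfU hU /and4P[/allP wsn uws sws /allP hs] actE PT.
set L := lat _ _ _.
set W := periodize L _.
pose C w := [set x | W x /\ has_return_word P act W i x w].
have leafU (x : plane) : exists2 w, w \in ws & teval U x = Some w.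
  by have /(allP hU)/mapP[w] := teval_leaves U x; exists w.
(* Exceptions arise only from a wild point among the first [n + 1] points of the orbit; elsewhere
   [run_sound] gives a return word and [return_word_unique] excludes any other. *)
have agreeC w : small [set x | box (zval a) (zval b) x /\
    ~ (C w x <-> teval U x = Some w)].
  apply: (@small_sub _ _ [set x | exists2 k, (k < n.+1)%N &
      ~ tame al ga be a b T P (act (unit_step i k) x)]); last first.
    apply: small_bigcup => k _.
    have := small_shift (vval st *+ k) (small_wild a b al0 be0 PT).
    by apply: small_sub => x /=; rewrite actE.
  move=> x [bx nC]; apply/not_exists2P => h; apply: nC.
  have tx k : (k <= n)%N -> tame al ga be a b T P (act (unit_step i k) x).
    by move=> kn; apply: contrapT => nt; case: (h k).
  have [w0 w0s Uw0] := leafU x.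
  have Wx : W x.
    by exists 0; [exact: lattice0|rewrite /= !subr0 -surjective_pairing].
  have v0 : vval (zz 0, zz 0) = 0 by rewrite /vval /= zval0.
  have Cw0 : has_return_word P act W i x w0.
    apply: (run_sound ale ble actE PT (acc := [::]) _ _ _ _ _ _ Uw0) => //.
    - exact/sat_box.
    - by exists 0; [exact: lattice0|rewrite v0 actE mulr0n subr0].
    - rewrite v0 addr0; case: bx => /andP[h1 h2] /andP[h3 h4].
      by split; apply/andP; split => //;
        [apply: lt_le_trans h2 _|apply: lt_le_trans h4 _].
    - by case=> [|k] /andP[].
  split=> [[_ Cw]|].
    rewrite Uw0; congr Some.
    apply: (return_word_unique PT _ Cw0 Cw) => k kw.
    by apply: tx; apply: leq_trans (ltnW kw) (wsn _ w0s).
  by rewrite Uw0 => -[<-].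
have cell_invariant w : lattice_invariant L (return_cell P act W i w).
  apply: interior_invariant; first exact: latticeN.
  exact: (has_return_word_invariant actE PT).
have agree_cell w : small [set x | box (zval a) (zval b) x /\
    ~ (return_cell P act W i w x <-> teval U x = Some w)].
  exact: (agree_interior (p := fun o => o = Some w) wfU (agreeC w)).
have dense_cell w x e : box (zval a) (zval b) x -> 0 < e ->
    exists y, [/\ near_pt x e y, box (zval a) (zval b) y &
      (return_cell P act W i w y <-> teval U y = Some w)].
  move=> bx e0.
  have [e' e'0 he'] : exists2 e', 0 < e' & forall y, near_pt x e' y ->
      near_pt x e y /\ box (zval a) (zval b) y.
    by apply: near_pt_min; [exists e|exact: box_near].
  have [y /he' [ye yb] ny] := small_dense x (agree_cell w) e'0.
  by exists y; split=> //; apply: contrapT => h; apply: ny.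
(* An open cell contains, up to translation, a point of the box where the tree is right, which
   forces [w] into [ws]. Conversely, the tree is constant near a sampled point, and some nearby
   point is in the cell. *)
have cellP w : return_cell P act W i w !=set0 <-> w \in ws.
  split=> [[x cx]|/(map_f Some)/hs/(sampled_sound a0 b0) [p [bp rp Up]]].
    have [[v hv bv] _] := interior_subset cx.
    have /interior_near[e e0 he] := cell_invariant w _ _ (latticeN hv) cx.
    have [y [ye yb hy]] := dense_cell w _ e bv e0.
    (* [he] only gives membership in the set whose interior is the cell; a smaller square around [y]
       gives the interior. *)
    have cy : return_cell P act W i w y.
      have [e' e'0 he'] := near_pt_ball ye.
      by apply/interior_near; exists e' => // z /he'/he.
    by have [w' ws' Uw'] := leafU y; move/hy: cy; rewrite Uw' => -[<-].
  have [e e0 he] := regular_near rp.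
  have [y [ye yb hy]] := dense_cell w _ e bp e0.
  by exists y; apply/hy; have [_ ->] := he y ye.
have rw : return_words P act W i = ws.
  rewrite /return_words -[RHS](sorted_sort radix_trans sws).
  apply/(perm_sortP radix_total radix_trans radix_anti).
  have -> : [set w | return_cell P act W i w !=set0] = [set` ws].
    by apply/seteqP; split=> w /cellP.
  apply: uniq_perm => [||w]; [exact: fset_uniq|exact: uws|].
  rewrite in_fset_set; last exact: finite_seq.
  by apply/idP/idP => [/set_mem|h]; last exact: mem_set.
split=> //; split.
- move=> l; rewrite /induced_partition rw /atom.
  have [lw|lw] := ltnP l (size ws).
    by rewrite (nth_map [::]) //; exact: periodize_invariant.
  by rewrite nth_default ?size_map // => x v _ [].
- by rewrite wf_tmap.
- rewrite /induced_partition size_map rw /index_tree leaves_tmap all_map.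
  apply: sub_all hU => o /mapP[w ww ->] /=.
  by rewrite index_mem.
- rewrite /induced_partition size_map rw => l lw.
  apply: (small_sub _ (agree_cell (nth [::] ws l))) => x [bx nx].
  split=> // h; apply: nx.
  rewrite /atom (nth_map [::]) // teval_tmap.
  rewrite (@periodize_box _ _ 0 _ _ _ _ _ (lexx _) (lexx _) bx).
  have [w0 w0s Uw0] := leafU x.
  rewrite Uw0 /=; rewrite Uw0 in h; split.
    by move=> [/h[->] _]; rewrite index_uniq.
  move=> E; split=> //; apply/h; congr Some; by rewrite -E nth_index.
Qed.

End Stage.

(** * Polygons and rescaling *)

(* The outer node tells apart the two orientations of a crossing edge. *)
Definition edge_tree (p q : zvec) : tree bool :=
  let dx := zsub q.1 p.1 in
  let dy := zsub q.2 p.2 in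
  let c : zaff := (zopp dy, dx, zsub (zmul dy p.1) (zmul dx p.2)) in
  let below_p : zaff := (zz 0, zz 1, zopp p.2) in
  let below_q : zaff := (zz 0, zz 1, zopp q.2) in
  Node below_p
    (Node below_q (Leaf false) (Node c (Leaf true) (Leaf false)))
    (Node below_q (Node (aopp c) (Leaf true) (Leaf false)) (Leaf false)).

Definition edge_trees (vs : seq zvec) : seq (tree bool) :=
  [seq edge_tree e.1 e.2 | e <- zip vs (rot 1 vs)].

Fixpoint explore_parity (B : eqType) (cs : seq zaff) (es : seq (tree bool))
    (par : bool) (k : seq zaff -> bool -> tree B) : tree B :=
  if es is e :: es' then
    explore cs e (fun cs' b => explore_parity cs' es' (par (+) b) k)
  else k cs par.

Fixpoint explore_union (B : eqType) (cs : seq zaff) (ps : seq (seq zvec))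
    (k : seq zaff -> bool -> tree B) : tree B :=
  if ps is vs :: ps' then
    explore_parity cs (edge_trees vs) false (fun cs' b =>
      if b then k cs' true else explore_union cs' ps' k)
  else k cs false.

(** Serves only to produce [tree0], which [polygon_check] verifies afterwards; the final [Leaf 0] is
    an arbitrary value for points in no polygon. *)
Fixpoint locate (cs : seq zaff) (pss : seq (seq (seq zvec))) (i : nat) : tree nat :=
  if pss is ps :: pss' then
    explore_union cs ps (fun cs' b =>
      if b then Leaf i else locate cs' pss' i.+1)
  else Leaf 0%N.

(** Goes on after index [l], so that it also shows that no other atom contains the point. *)
Fixpoint check_label (cs : seq zaff) (pss : seq (seq (seq zvec))) (i l : nat)
    : tree bool :=
  if pss is ps :: pss' then
    explore_union cs ps (fun cs' b =>
      if b == (i == l) then check_label cs' pss' i.+1 l else Leaf false)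
  else Leaf true.

(** The bounds on vertices keep the polygons in the closed fundamental domain, so that their
    translates do not overlap it. *)
Definition polygon_check (al be : zphi) (pss : seq (seq (seq zvec))) (T : tree nat)
    : bool :=
  [&& zpos al, zpos be, wf T, all (fun l => l < size pss)%N (leaves T),
    all (all (fun vs => all (@wf bool) (edge_trees vs))) pss,
    all (all (all (fun v => [&& znonneg v.1, znonneg (zsub al v.1),
      znonneg v.2 & znonneg (zsub be v.2)]))) pss
    & all id (leaves (explore (box_forms al be) T
      (fun cs l => check_label cs pss 0 l)))].

Section Polygons.
Variable R : realType.
Local Notation plane := (R * R)%type.
Local Notation zval := (@zval R).
Local Notation vval := (@vval R).

Lemma crosses_edge p q x : tregular (edge_tree p q) x ->
  crosses x (vval p) (vval q) = teval (edge_tree p q) x.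
Proof.
rewrite /crosses /vval /= !zev_aopp /zev /ev /= !zvalE.
rewrite !mul0r !add0r !mul1r !subr_eq0 !subr_gt0 oppr_gt0.
set D := zval q.2 - zval p.2; set d := zval q.1 - zval p.1.
set c := - D * x.1 + d * x.2 + _ => hr.
(* [D] is kept as a factor because its sign distinguishes the two orientations of the edge, for
   which [c] must have opposite signs. *)
have cross : D != 0 -> (x.1 < zval p.1 + (x.2 - zval p.2) / D * d) =
    (0 < D * (c / (D * D))).
  move=> D0; rewrite -subr_gt0; congr (0 < _); rewrite /c; field.
  by rewrite D0.
case: (ltgtP (zval p.2) x.2) hr => [lp|lp|//]; rewrite /=;
  case: (ltgtP (zval q.2) x.2) => [lq|lq|//] //= _.
- have D0 : 0 < D by rewrite subr_gt0 (lt_trans lp).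
  rewrite cross ?gt_eqF // pmulr_rgt0 // pmulr_lgt0 ?invr_gt0 ?mulr_gt0 //.
  by case: ifP.
- have D0 : D < 0 by rewrite subr_lt0 (lt_trans lq).
  rewrite cross ?lt_eqF // nmulr_rgt0 // pmulr_llt0 ?invr_gt0 ?nmulr_lgt0 //.
  by case: ifP.
Qed.

Lemma wf_edges_small vs : all (@wf bool) (edge_trees vs) ->
  small [set x : plane | ~~ all (fun e => tregular e x) (edge_trees vs)].
Proof.
elim: (edge_trees vs) => [|e es IH] /=.
  by move=> _; apply: (small_sub _ (@small0 R)).
move=> /andP[we /IH ses]; apply: (small_sub _ (smallU (small_irregular we) ses)).
by move=> x /=; rewrite negb_and => /orP.
Qed.

Definition parity (es : seq (tree bool)) (x : plane) : bool :=
  odd (count (fun e => teval e x) es).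

Lemma polygon_parity vs x : all (fun e => tregular e x) (edge_trees vs) ->
  polygon [seq vval v | v <- vs] x <-> parity (edge_trees vs) x.
Proof.
rewrite /polygon /parity /edge_trees /=.
have -> : zip (map vval vs) (rot 1 (map vval vs)) =
    [seq (vval e.1, vval e.2) | e <- zip vs (rot 1 vs)].
  rewrite -map_rot.
  by elim: vs (rot 1 vs) => [|v vs IH] [|w ws] //=; rewrite IH.
rewrite !count_map all_map => /allP h.
rewrite (@eq_in_count _ _ (fun e => teval (edge_tree e.1 e.2) x)) //.
by move=> e /h re; exact: crosses_edge.
Qed.

Lemma parity_near es x : all (fun e => tregular e x) es ->
  exists2 d, 0 < d & forall y, near_pt x d y ->
    all (fun e => tregular e y) es /\ parity es y = parity es x.
Proof.
elim: es => [|e es IH] /=; first by exists 1.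
move=> /andP[/regular_near H1 /IH H2].
have [d d0 hd] := near_pt_min H1 H2; exists d => // y /hd [[h1 h2] [h3]].
by rewrite /parity /= !oddD h1 h2 h3 => ->.
Qed.

(** The parity is locally constant off the lines of the edge trees, so taking the interior loses
    nothing there. *)
Lemma polygon_interior vs x : all (fun e => tregular e x) (edge_trees vs) ->
  (polygon [seq vval v | v <- vs])° x <-> parity (edge_trees vs) x.
Proof.
move=> rx; split=> [/interior_subset|px]; first by move/(polygon_parity rx).
have [d d0 hd] := parity_near rx; apply/interior_near; exists d => // y /hd [ry py].
by apply/polygon_parity => //; rewrite py.
Qed.

Lemma explore_parity_sound (B : eqType) (Q : B -> Prop) x es cs par k :
  sat cs x -> all (fun e => tregular e x) es ->
  (forall cs', sat cs' x -> Q (teval (k cs' (par (+) parity es x)) x)) ->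
  Q (teval (explore_parity cs es par k) x).
Proof.
elim: es cs par => [|e es IH] cs par hcs /=.
  by move=> _ /(_ _ hcs); rewrite /parity /= addbF.
move=> /andP[re res] hQ; apply: (explore_sound (Q := Q)) => // cs' hcs'.
apply: IH => // cs2 hcs2; have := hQ _ hcs2.
by rewrite {1}/parity /= oddD oddb addbA.
Qed.

Definition in_union (ps : seq (seq zvec)) (x : plane) : bool :=
  has (fun vs => parity (edge_trees vs) x) ps.

Definition edges_regular (ps : seq (seq zvec)) (x : plane) : bool :=
  all (fun vs => all (fun e => tregular e x) (edge_trees vs)) ps.

Lemma explore_union_sound (B : eqType) (Q : B -> Prop) x ps cs k :
  sat cs x -> edges_regular ps x ->
  (forall cs', sat cs' x -> Q (teval (k cs' (in_union ps x)) x)) ->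
  Q (teval (explore_union cs ps k) x).
Proof.
elim: ps cs => [|vs ps IH] cs hcs /=; first by move=> _; apply.
move=> /andP[rvs rps] hQ; apply: (explore_parity_sound (Q := Q)) => // cs' hcs'.
rewrite addFb; case E : (parity _ _).
  by have := hQ _ hcs'; rewrite /in_union /= E.
by apply: IH => // cs2 hcs2; have := hQ _ hcs2; rewrite {1}/in_union /= E.
Qed.

Lemma check_label_sound x pss cs i l :
  sat cs x -> all (edges_regular^~ x) pss ->
  teval (check_label cs pss i l) x ->
  forall j, (j < size pss)%N -> in_union (nth [::] pss j) x = (i + j == l)%N.
Proof.
elim: pss cs i => [|ps pss IH] cs i hcs //= /andP[rps rpss].
pose Q b := is_true b -> forall j, (j < (size pss).+1)%N ->
  in_union (nth [::] (ps :: pss) j) x = (i + j == l)%N.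
apply: (explore_union_sound (Q := Q)) => // cs' hcs'; rewrite /Q.
case: eqP => // E ht [|j] jp /=; first by rewrite addn0.
by rewrite addnS -addSn; apply: IH ht _ _.
Qed.

(** In particular a closed cycle has an even number of changes. *)
Lemma odd_changes (A : Type) (b : A -> bool) x s y :
  odd (count (fun e => b e.1 != b e.2) (zip (x :: s) (rcons s y))) =
  (b x != b y).
Proof.
elim: s x => [|z s IH] x /=; first by rewrite addn0 oddb.
by rewrite oddD oddb IH; case: (b x); case: (b z); case: (b y).
Qed.

Lemma mem_zip (A : eqType) (s t : seq A) e :
  e \in zip s t -> e.1 \in s /\ e.2 \in t.
Proof.
elim: s t => [|x s IH] [|y t] //=; rewrite !inE => /orP[/eqP ->|/IH[-> ->]].
  by rewrite !eqxx.
by rewrite !orbT.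
Qed.

(** From the left of the box, the ray crosses every edge that straddles its height, an even number
    on a closed polygon; from the other three sides it crosses none. *)
Lemma polygon_outside (al be : R) (vs : seq plane) x :
  (forall p, p \in vs -> 0 <= p.1 <= al /\ 0 <= p.2 <= be) ->
  x.1 < 0 \/ al < x.1 \/ x.2 < 0 \/ be < x.2 -> ~ polygon vs x.
Proof.
move=> hvs hx; rewrite /polygon /=; apply/negP.
have interp (p q : plane) : p \in vs -> q \in vs ->
    (p.2 <= x.2) != (q.2 <= x.2) ->
    0 <= p.1 + (x.2 - p.2) / (q.2 - p.2) * (q.1 - p.1) <= al.
  move=> /hvs [/andP[p0 p1] _] /hvs [/andP[q0 q1] _] hpq.
  have : 0 <= (x.2 - p.2) / (q.2 - p.2) <= 1.
    move: hpq; case: leP => h1; case: leP => // h2 _.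
      have h : 0 < q.2 - p.2 by lra.
      by rewrite ler_pdivrMr // divr_ge0 ?(ltW h) //=; lra.
    have h : 0 < p.2 - q.2 by lra.
    rewrite -mulrNN -invrN !opprB ler_pdivrMr // divr_ge0 ?(ltW h) //=; lra.
  move: (_ / _) => k /andP[k0 k1].
  have m1 := mulr_ge0 k0 q0; have m2 : 0 <= (1 - k) * p.1 by apply: mulr_ge0; lra.
  have m3 : 0 <= k * (al - q.1) by apply: mulr_ge0; lra.
  have m4 : 0 <= (1 - k) * (al - p.1) by apply: mulr_ge0; lra.
  by apply/andP; split; lra.
have memz e : e \in zip vs (rot 1 vs) -> e.1 \in vs /\ e.2 \in vs.
  by move=> /mem_zip; rewrite mem_rot.
case: hx => [x1|hx].
  rewrite (@eq_in_count _ _ (fun e => (e.1.2 <= x.2) != (e.2.2 <= x.2))).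
    case: (vs) => [//|p s]; rewrite rot1_cons.
    by rewrite (odd_changes (fun p : plane => p.2 <= x.2)) eqxx.
  move=> e /memz [h1 h2]; rewrite /crosses.
  case E : (_ != _) => //=; have := interp _ _ h1 h2 E; lra.
rewrite (@eq_in_count _ _ pred0) ?count_pred0 //.
move=> e /memz [h1 h2]; rewrite /crosses /=; apply/negP => /andP[E].
have [_ /andP[a1 a2]] := hvs _ h1; have [_ /andP[b1 b2]] := hvs _ h2.
case: hx => [x1|[x2|x2]].
- have := interp _ _ h1 h2 E; lra.
- by move: E; rewrite !leNgt (lt_le_trans x2 a1) (lt_le_trans x2 b1).
- by move: E; rewrite (le_trans a2 (ltW x2)) (le_trans b2 (ltW x2)).
Qed.

Lemma edges_regular_small ps :
  all (fun vs => all (@wf bool) (edge_trees vs)) ps ->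
  small [set x : plane | ~~ edges_regular ps x].
Proof.
elim: ps => [|vs ps IH] /=; first by move=> _; apply: (small_sub _ (@small0 R)).
move=> /andP[/wf_edges_small s1 /IH s2]; apply: (small_sub _ (smallU s1 s2)).
by move=> x /=; rewrite negb_and => /orP.
Qed.

Definition polygon_union (ps : seq (seq zvec)) : set plane :=
  \big[setU/set0]_(vs <- [seq [seq vval v | v <- vs] | vs <- ps]) (polygon vs)°.

Lemma polygon_unionP ps x : edges_regular ps x ->
  polygon_union ps x <-> in_union ps x.
Proof.
rewrite /polygon_union big_map -bigcup_seq => /allP rx; split.
  by move=> [vs vps /(polygon_interior (rx _ vps)) h]; apply/hasP; exists vs.
by move=> /hasP[vs vps h]; exists vs => //; apply/(polygon_interior (rx _ vps)).
Qed.

(** [box] is open while [polygon] may contain part of its edges, so a point on the frame is first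
    pushed off the closed box. *)
Lemma strictly_outside (a b : R) (y : plane) e : 0 < e -> ~ box a b y ->
  exists2 z, near_pt y e z & z.1 < 0 \/ a < z.1 \/ z.2 < 0 \/ b < z.2.
Proof.
move=> e0 nb; have e2 : 0 < e / 2 by lra.
have ne : `|e / 2| < e by rewrite gtr0_norm //; lra.
have h : y.1 <= 0 \/ a <= y.1 \/ y.2 <= 0 \/ b <= y.2.
  apply: contrapT.
  move=> /not_orP[/negP h1 /not_orP[/negP h2 /not_orP[/negP h3 /negP h4]]].
  by apply: nb; split; apply/andP; split; rewrite ltNge.
have n1 (r : R) : `|r - e / 2 - r| < e by rewrite addrAC subrr add0r normrN.
have n2 (r : R) : `|r + e / 2 - r| < e by rewrite addrAC subrr add0r.
case: h => [h|[h|[h|h]]].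
- exists (y.1 - e / 2, y.2); first by split; rewrite //= subrr normr0.
  by left => /=; lra.
- exists (y.1 + e / 2, y.2); first by split; rewrite //= subrr normr0.
  by right; left => /=; lra.
- exists (y.1, y.2 - e / 2); first by split; rewrite //= subrr normr0.
  by right; right; left => /=; lra.
- exists (y.1, y.2 + e / 2); first by split; rewrite //= subrr normr0.
  by right; right; right => /=; lra.
Qed.

Lemma polygon_described al ga be pss T : polygon_check al be pss T ->
  described (zval al) (zval ga) (zval be)
    (polygon_partition (lat (zval al) (zval ga) (zval be))
      [seq [seq [seq vval v | v <- vs] | vs <- ps] | ps <- pss]) T.
Proof.
case/and5P => /(@zpos_gt0 R) al0 /(@zpos_gt0 R) be0 wfT hT.
case/and3P => wfE /allP vbox /allP chk.
have sizeP : size (polygon_partition (lat (zval al) (zval ga) (zval be))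
    [seq [seq [seq vval v | v <- vs] | vs <- ps] | ps <- pss]) = size pss.
  by rewrite !size_map.
have atomE l : (l < size pss)%N ->
    atom (polygon_partition (lat (zval al) (zval ga) (zval be))
      [seq [seq [seq vval v | v <- vs] | vs <- ps] | ps <- pss]) l =
    periodize (lat (zval al) (zval ga) (zval be))
      (polygon_union (nth [::] pss l)).
  by move=> lp; rewrite /atom /polygon_partition -map_comp (nth_map [::]).
have inside ps (y : plane) : ps \in pss -> polygon_union ps y ->
    box (zval al) (zval be) y.
  move=> /vbox /allP hps; rewrite /polygon_union big_map -bigcup_seq.
  move=> [vs /hps /allP hvs /interior_near[e e0 he]]; apply: contrapT => nb.
  have [z /he pz zo] := strictly_outside e0 nb.
  apply: polygon_outside zo pz => _ /mapP[v /hvs /and4P[h1 h2 h3 h4] ->].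
  move: h1 h2 h3 h4 => /(@znonneg_ge0 R) h1 /(@znonneg_ge0 R) h2.
  move=> /(@znonneg_ge0 R) h3 /(@znonneg_ge0 R).
  by move: h2; rewrite !zvalB !subr_ge0 /vval /= h1 h3 => -> ->.
split => //.
- move=> l; have [lp|lp] := ltnP l (size pss).
    by rewrite atomE //; exact: periodize_invariant.
  by rewrite /atom nth_default ?sizeP // => x v _ [].
- by rewrite sizeP.
rewrite sizeP => l lp; rewrite atomE //.
have sE : small [set x : plane | exists2 j, (j < size pss)%N &
    ~~ edges_regular (nth [::] pss j) x].
  apply: small_bigcup => j jp; apply: edges_regular_small.
  exact: (allP wfE _ (mem_nth _ jp)).
apply: (small_sub _ (smallU sE (small_irregular wfT))) => x [bx nx].
have [rT|nT] := boolP (tregular T x); last by right.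
left; apply/not_exists2P => h; apply: nx.
have rE : all (edges_regular^~ x) pss.
  apply/(all_nthP [::]) => j jp.
  by case: (h j) => // /negP; rewrite negbK.
have main : forall j, (j < size pss)%N ->
    in_union (nth [::] pss j) x = (j == teval T x)%N.
  pose Q b := is_true b -> forall j, (j < size pss)%N ->
    in_union (nth [::] pss j) x = (j == teval T x)%N.
  have : Q (teval (explore (box_forms al be) T
      (fun cs l => check_label cs pss 0 l)) x).
    apply: (explore_sound (Q := Q)) => //; first exact/sat_box.
    by move=> cs' hcs' /(check_label_sound hcs' rE) hj j /hj ->.
  by apply; apply: chk; exact: teval_leaves.
have ux : periodize (lat (zval al) (zval ga) (zval be))
    (polygon_union (nth [::] pss l)) x <-> polygon_union (nth [::] pss l) x.
  split; last first.
    by exists 0; [exact: lattice0|rewrite /= !subr0 -surjective_pairing].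
  move=> [v hv uv]; have bv := inside _ _ (mem_nth _ lp) uv.
  have v0 : v = 0.
    by apply: (box_unique (x := x) hv (lattice0 _ _ _)); rewrite ?subr0.
  by move: uv; rewrite v0 /= !subr0 -surjective_pairing.
apply: (iff_trans ux).
apply: (iff_trans (polygon_unionP (allP rE _ (mem_nth _ lp)))).
by rewrite main // eq_sym; split=> /eqP.
Qed.

End Polygons.

Lemma leaves_tsubst (A : Type) p q (T : tree A) : leaves (tsubst p q T) = leaves T.
Proof. by elim: T => //= c T1 -> T2 ->. Qed.

(** * Images of described partitions under rescalings *)

Section Maps.
Variable R : realType.
Local Notation plane := (R * R)%type.
Local Notation zval := (@zval R).
Local Notation vval := (@vval R).

(* [f] maps the torus [R^2 / L] to [R^2 / L'], with inverse
   [y |-> (q.1 y.1, q.2 y.2)], and the translate by [p] brings the fundamental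
   domain of [L'] back onto that of [L]. *)
Lemma described_map (al be al' be' : R) (p q : zvec) (f : plane -> plane) P T :
  wf (tsubst p q T) -> zval q.1 != 0 -> zval q.2 != 0 ->
  (forall y, f (zval q.1 * y.1, zval q.2 * y.2) = y) ->
  (forall x, (zval q.1 * (f x).1, zval q.2 * (f x).2) = x) ->
  lattice (rectangular al be) (vval p) ->
  (forall v, lattice (rectangular al' be') v ->
     lattice (rectangular al be) (zval q.1 * v.1, zval q.2 * v.2)) ->
  (forall y, box al' be' y -> box al be (diag (vval p) (vval q) y)) ->
  described al 0 be P T ->
  described al' 0 be' (map_partition f P) (tsubst p q T).
Proof.
move=> wfT q1 q2 fK Kf Lp Lq hbox [iP _ lP aP].
have atomE l y : (l < size P)%N -> atom (map_partition f P) l y <->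
    atom P l (zval q.1 * y.1, zval q.2 * y.2).
  move=> ls; rewrite /atom /map_partition (nth_map set0) //.
  split=> [[x Ax <-]|Ay]; first by rewrite Kf.
  by exists (zval q.1 * y.1, zval q.2 * y.2).
split => //.
- move=> l x v hv; have [ls|ls] := ltnP l (size P); last first.
    by rewrite /atom nth_default ?size_map.
  rewrite !atomE //= !mulrDr => /(iP l _ _ (Lq _ hv)).
  by [].
- by rewrite size_map leaves_tsubst.
- rewrite size_map => l ls.
  have := @small_diag _ (vval p) (vval q) _ q1 q2 (aP l ls).
  apply: small_sub => y [by' ny]; split; first exact: hbox.
  rewrite -teval_tsubst; apply: contra_not ny => <-.
  rewrite atomE //.
  have -> : diag (vval p) (vval q) y = (zval q.1 * y.1, zval q.2 * y.2) + vval p.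
    by rewrite /diag /vval /= addrC [zval p.2 + _]addrC.
  by apply: iff_sym; apply: (invariantE _ _ Lp); apply: iP.
Qed.

End Maps.

(** * The partitions of the Jeandel-Rao shift *)

Definition z0 : zphi := (0, 0).
Definition z1 : zphi := (1, 0).
Definition z2 : zphi := (2, 0).
Definition zf : zphi := (0, 1).
Definition zf1 : zphi := (1, 1).
Definition zf2 : zphi := (2, 1).
Definition zf3 : zphi := (3, 1).
Definition zs : zphi := (-1, 1).
Definition zt : zphi := (2, -1).
Definition z2t : zphi := (4, -2).
Definition zu : zphi := (-3, 2).

Definition polygons0 : seq (seq (seq zvec)) :=
  [:: [:: [:: (z0, z0); (zs, z0); (zs, z1)];
          [:: (zs, z0); (z1, z0); (z1, z1)];
          [:: (z1, z0); (zf, z0); (zf, z1)]];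
      [:: [:: (z0, z0); (zs, z1); (z0, z1)];
          [:: (zs, z0); (z1, z1); (zs, z1)];
          [:: (z1, z0); (zf, z1); (z1, z1)]];
      [:: [:: (z0, z2); (zs, zf2); (z0, zf1)]];
      [:: [:: (z1, z1); (zf, z2); (zf, zf2); (z1, z2)]];
      [:: [:: (z0, z2); (z1, zf2); (z1, zf3)]];
      [:: [:: (z0, zf1); (zs, zf2); (z1, zf3); (zt, zf2); (zt, zf3);
           (z0, zf2)]];
      [:: [:: (z0, zf2); (zt, zf3); (z0, zf3)];
          [:: (zt, zf2); (z1, zf3); (zt, zf3)];
          [:: (z1, zf2); (zf, zf3); (z1, zf3)]];
      [:: [:: (z0, z1); (z1, zf2); (z0, z2)];
          [:: (z1, zf1); (zf, zf2); (zf, zf3); (z1, zf2)]];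
      [:: [:: (zs, z1); (zf, zf2); (zs, z2)]];
      [:: [:: (z0, z1); (zs, z1); (zs, z2)];
          [:: (zs, z1); (z1, z1); (z1, z2)];
          [:: (z1, z1); (zf, z1); (zf, z2)]];
      [:: [:: (z0, z1); (z1, zf1); (z1, zf2)]]].

Definition polygonsU : seq (seq (seq zvec)) :=
  [:: [:: [:: (zs, zs); (z2t, zs); (zs, z2t)]];
      [:: [:: (z2t, zs); (z1, zs); (z1, z1); (zs, z1); (zs, z2t)]];
      [:: [:: (zu, zs); (zt, zs); (z0, z1)]];
      [:: [:: (z0, zs); (zu, zs); (z0, z1)]];
      [:: [:: (zs, zs); (zs, z2t); (zt, z1)]];
      [:: [:: (zs, z2t); (zs, z1); (zt, z1)]];
      [:: [:: (zt, zs); (zt, z1); (z0, z1)]];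
      [:: [:: (zt, zs); (zs, zs); (zt, z1)]];
      [:: [:: (zs, z0); (z1, z0); (zs, zt)]];
      [:: [:: (z1, z0); (z1, zt); (z2t, zs); (zs, zs)]];
      [:: [:: (z1, zt); (z1, zs); (z2t, zs)]];
      [:: [:: (zs, zt); (z1, z0); (zs, zs)]];
      [:: [:: (zt, zt); (zt, zs); (zu, zs)]];
      [:: [:: (zs, z0); (zs, zt); (zt, zs); (zt, zt)]];
      [:: [:: (zt, z0); (zt, zt); (zu, zs); (z0, zs)]];
      [:: [:: (zt, z0); (zs, z0); (zt, zt)]];
      [:: [:: (z0, z0); (zt, z0); (z0, zt)]];
      [:: [:: (zt, z0); (z0, zs); (z0, zt)]];
      [:: [:: (zs, zt); (zs, zs); (zt, zs)]]].

(** The theorem prescribes only a composite of [beta8], [beta9] and [tau]; the lists [words8],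
    [words9] and [tau] are candidates, confirmed by [stage_check] and [compare_tau]. *)
Definition words8 : seq (seq nat) :=
  [:: [:: 2]; [:: 3]; [:: 4]; [:: 12]; [:: 13]; [:: 14]; [:: 16]; [:: 17];
     [:: 2; 0]; [:: 3; 1]; [:: 4; 1]; [:: 5; 1]; [:: 12; 7]; [:: 13; 6]; [::
     14; 6]; [:: 14; 8]; [:: 15; 11]; [:: 16; 9]; [:: 16; 10]; [:: 17; 7];
     [:: 18; 10]]%N.

Definition words9 : seq (seq nat) :=
  [:: [:: 3]; [:: 7]; [:: 12]; [:: 17]; [:: 18]; [:: 19]; [:: 3; 0]; [:: 4;
     0]; [:: 4; 1]; [:: 5; 2]; [:: 6; 0]; [:: 7; 0]; [:: 13; 9]; [:: 14;
     10]; [:: 15; 10]; [:: 16; 11]; [:: 17; 8]; [:: 18; 9]; [:: 20; 10]]%N.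

Definition tau : seq nat :=
  [:: 1; 0; 4; 3; 5; 2; 10; 9; 11; 8; 7; 6; 15; 18; 17; 16; 13; 14; 12]%N.

(** [flatten] inverts [row_word] and [col_word] alike. *)
Definition words (f : morphism) : seq (seq nat) := [seq flatten w | w <- f].

(* [treek] describes the k-th partition (a prime marks a rescaled one), and
   [treeU] the partition P_U. *)
Definition tree0 : tree nat := Eval vm_compute in
  locate (box_forms zf zf3) polygons0 0.
Definition tree1 := Eval vm_compute in index_tree (words omega0123)
  (return_tree 5 zf z1 zf3 zf z1 (z0, z1) tree0).
Definition tree3 := Eval vm_compute in index_tree (words kappa)
  (return_tree 5 zf z0 z1 z1 z1 (z1, z0) tree1).
Definition tree4 := Eval vm_compute in index_tree (words omega7)
  (return_tree 5 z1 z0 z1 zs z1 (zt, z0) tree3).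
Definition tree5 := Eval vm_compute in index_tree (words omega8)
  (return_tree 5 zs z0 z1 zs zs (z0, zt) tree4).
(** In each coordinate, the inverse of [h] followed by the translation by [zs], which brings (-s, 0)
    back to (0, s). *)
Definition tree5' := tsubst (zs, zs) (zopp zs, zopp zs) tree5.
Definition tree6 := Eval vm_compute in index_tree (words omega9)
  (return_tree 5 z1 z0 z1 zs z1 (zt, z0) tree5').
Definition tree7 := Eval vm_compute in index_tree (words omega10)
  (return_tree 5 zs z0 z1 zs zs (z0, zt) tree6).
Definition tree7' := tsubst (zs, zs) (zopp zs, zopp zs) tree7.
Definition tree8 := Eval vm_compute in index_tree (words omega11)
  (return_tree 5 z1 z0 z1 zs z1 (zt, z0) tree7').
Definition tree9 := Eval vm_compute in index_tree words8
  (return_tree 5 zs z0 z1 zs zs (z0, zt) tree8).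
Definition tree9' := tsubst (zs, zs) (zopp zs, zopp zs) tree9.
Definition tree10 := Eval vm_compute in index_tree words9
  (return_tree 5 z1 z0 z1 zs z1 (zt, z0) tree9').
Definition tree8' := tsubst (zs, z0) (zopp zs, z1) tree8.
(** Not computed from the polygons but from the rescaled [tree8], relabelled by the inverse of
    [rho]. The geometric content of [zeta = rho] is thus checked in [describedU], and [compare_rho]
    compares a tree with its own relabelling. *)
Definition treeU := tmap (index^~ rho) tree8'.

Definition compare (al be : zphi) (T U : tree nat) (f : nat -> nat) : bool :=
  all id (leaves (explore (box_forms al be) T (fun cs l =>
    explore cs U (fun _ l' => Leaf (f l == l'))))).

Lemma wf_rescaled : [/\ wf tree5', wf tree7' & wf tree9'].
Proof. by vm_compute. Qed.

Lemma wf_tree8' : wf tree8'.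
Proof. by vm_compute. Qed.

Lemma compare_tau : compare zs z1 tree8 tree10 (nth 0%N tau).
Proof. by vm_compute. Qed.

Lemma compare_rho : compare z1 z1 treeU tree8' (nth 0%N rho).
Proof. by vm_compute. Qed.

(** Every label occurs on an open set, whence the uniqueness of [tau]. *)
Lemma sampled10 : all (sampled zs z1 9 tree10) (iota 0 19).
Proof. by vm_compute. Qed.

Lemma sampled8' : all (sampled z1 z1 9 tree8') (iota 0 19).
Proof. by vm_compute. Qed.

Lemma tau_bijection : index_bijection 19 19 tau.
Proof. by split. Qed.

Lemma rho_bijection : index_bijection 19 19 rho.
Proof. by split. Qed.

Lemma index_bijection_lt m n t a : index_bijection m n t -> (a < m)%N ->
  (nth 0%N t a < n)%N.
Proof.
move=> [st pt] am; have : nth 0%N t a \in t by rewrite mem_nth ?st.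
by rewrite (perm_mem pt) mem_iota.
Qed.

Lemma index_bijection_inj m n t : index_bijection m n t ->
  {in gtn m &, injective (nth 0%N t)}.
Proof.
move=> [st pt] a b am bm /eqP; rewrite nth_uniq ?st //; first by move/eqP.
by rewrite (perm_uniq pt) iota_uniq.
Qed.

(** * Bijections between the atoms of two partitions *)

Section Comparison.
Variable R : realType.
Local Notation plane := (R * R)%type.
Local Notation zval := (@zval R).
Local Notation vval := (@vval R).
Variables (al be : zphi).
Hypotheses (al0 : zpos al) (be0 : zpos be).

(** At generic points [compare] sends the label in [T] to the label in [U]; injectivity of [f] makes
    membership in the two atoms equivalent. *)
Lemma described_compare P Q T U (f : nat -> nat) :
  described (zval al) 0 (zval be) P T -> described (zval al) 0 (zval be) Q U ->
  compare al be T U f -> (forall l, (l < size P)%N -> (f l < size Q)%N) ->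
  {in gtn (size P) &, injective f} ->
  forall l, (l < size P)%N ->
  eq_mod_segments (rectangular (zval al) (zval be)) (atom Q (f l)) (atom P l).
Proof.
move: al0 be0 => /(@zpos_gt0 R) a0 /(@zpos_gt0 R) b0.
move=> [iP wT lT aT] [iQ wU lU aU] /allP cmp fQ finj l lP.
apply: small_eq_mod_segments => //.
apply: (@small_invariant _ _ 0 _ a0 b0).
  move=> x v hv; have hv' := latticeN hv.
  by case=> -[h1 h2]; [left|right]; split;
    rewrite ?(invariantE x (iQ _) hv) ?(invariantE x (iP _) hv).
have s1 := aT l lP; have s2 := aU _ (fQ l lP).
apply: (small_sub _ (smallU (smallU s1 s2)
  (smallU (small_irregular wT) (small_irregular wU)))) => x [bx xD].
have [rT|nT] := boolP (tregular T x); last by right; left.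
have [rU|nU] := boolP (tregular U x); last by right; right.
left; apply: contrapT => /not_orP[n1 n2].
have {n1} n1 : atom P l x <-> teval T x = l by apply: contrapT => h; apply: n1.
have {n2} n2 : atom Q (f l) x <-> teval U x = f l.
  by apply: contrapT => h; apply: n2.
pose C b := is_true b -> f (teval T x) = teval U x.
have fT : f (teval T x) = teval U x.
  have : C (teval (explore (box_forms al be) T (fun cs l =>
      explore cs U (fun _ l' => Leaf (f l == l')))) x).
    apply: (explore_sound (Q := C)) => //; first exact/sat_box.
    move=> cs hcs; apply: (explore_sound (Q := C)) => //.
    by move=> cs' _ /eqP.
  by apply; apply: cmp; exact: teval_leaves.
have E : atom P l x <-> atom Q (f l) x.
  rewrite n1 n2 -fT; split=> [->//|]; apply: finj => //.
  exact: (allP lT _ (teval_leaves _ _)).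
by case: xD => -[h1]; apply; apply/E.
Qed.

(** Near a point sampled for [nth 0 t a], some generic point lies in that atom, hence in [A a],
    hence in the atom given by [t']; its label is both indices. *)
Lemma bijection_unique N m P T (A : nat -> set plane) (t t' : seq nat) :
  described (zval al) 0 (zval be) P T ->
  all (sampled al be N T) (iota 0 (size P)) ->
  index_bijection m (size P) t -> index_bijection m (size P) t' ->
  (forall a, (a < m)%N -> eq_mod_segments (rectangular (zval al) (zval be))
     (atom P (nth 0%N t a)) (A a)) ->
  (forall a, (a < m)%N -> eq_mod_segments (rectangular (zval al) (zval be))
     (atom P (nth 0%N t' a)) (A a)) ->
  t = t'.
Proof.
move: al0 be0 => /(@zpos_gt0 R) a0 /(@zpos_gt0 R) b0.
move=> [_ _ _ aT] /allP hs bt bt' h h'.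
have [st _] := bt; have [st' _] := bt'.
apply: (@eq_from_nth _ 0%N); rewrite st ?st' // => a am.
have tP := index_bijection_lt bt am; have tP' := index_bijection_lt bt' am.
have s := eq_mod_segments_small a0 b0 (h a am).
have s' := eq_mod_segments_small a0 b0 (h' a am).
have /hs/(sampled_sound a0 b0) [p [bp rp Tp]] : nth 0%N t a \in iota 0 (size P).
  by rewrite mem_iota.
have [e e0 he] := near_pt_min (box_near bp) (regular_near rp).
have [y /he [yb [_ Ty]]] := small_dense p
  (smallU (smallU s s') (smallU (aT _ tP) (aT _ tP'))) e0.
move=> /not_orP[/not_orP[n1 n2] /not_orP[n3 n4]].
have y3 : atom P (nth 0%N t a) y.
  by apply: contrapT => hy; apply: n3; split=> //; rewrite Ty Tp; tauto.
have yA : A a y by apply: contrapT => hy; apply: n1; left.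
have y4 : atom P (nth 0%N t' a) y by apply: contrapT => hy; apply: n2; right.
rewrite -Tp -Ty; apply: contrapT => hy; apply: n4; split=> // E.
by apply: hy; apply/E.
Qed.

End Comparison.

(** * The nine inductions with their actual constants *)

Section Instances.
Variable R : realType.
Local Notation plane := (R * R)%type.
Local Notation zval := (@zval R).
Local Notation vval := (@vval R).
Local Notation phi := (phi R).

Lemma zval_pair (a b : Z) : zval (a, b) = (int_of_Z a)%:~R + (int_of_Z b)%:~R * phi.
Proof. by []. Qed.

Lemma phi_neq0 : phi != 0.
Proof. by rewrite gt_eqF // (lt_trans ltr01) // phi_gt1. Qed.

Lemma phiV : phi^-1 = phi - 1.
Proof.
have := phi_sqr R; have := phi_neq0; move: phi => f f0 hf.
by apply: (mulfI f0); rewrite mulfV //; ring: hf.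
Qed.

Lemma phiV2 : phi ^- 2 = 2 - phi.
Proof.
rewrite -exprVn phiV; have := phi_sqr R; move: phi => f hf.
by ring: hf.
Qed.

Lemma phiV3 : phi ^- 3 = 2 * phi - 3.
Proof.
rewrite -exprVn phiV; have := phi_sqr R; move: phi => f hf.
by ring: hf.
Qed.

Lemma zval_z0 : zval z0 = 0. Proof. by rewrite zval_pair /= mul0r addr0. Qed.
Lemma zval_z1 : zval z1 = 1. Proof. by rewrite zval_pair /= mul0r addr0. Qed.
Lemma zval_z2 : zval z2 = 2. Proof. by rewrite zval_pair /= mul0r addr0. Qed.
Lemma zval_zf : zval zf = phi. Proof. by rewrite zval_pair /= mul1r add0r. Qed.
Lemma zval_zf1 : zval zf1 = phi + 1. Proof. by rewrite zval_pair /= mul1r addrC. Qed.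
Lemma zval_zf2 : zval zf2 = phi + 2. Proof. by rewrite zval_pair /= mul1r addrC. Qed.
Lemma zval_zf3 : zval zf3 = phi + 3. Proof. by rewrite zval_pair /= mul1r addrC. Qed.
Lemma zval_zs : zval zs = phi^-1.
Proof. by rewrite zval_pair phiV mul1r addrC. Qed.
Lemma zval_zt : zval zt = phi ^- 2.
Proof. by rewrite zval_pair phiV2 mulN1r. Qed.
Lemma zval_zu : zval zu = phi ^- 3.
Proof. by rewrite zval_pair phiV3 addrC. Qed.
Lemma zval_z2t : zval z2t = 2 * phi ^- 2.
Proof. by rewrite zval_pair phiV2 mulrBr -natrM /= mulNr. Qed.

Definition zvals := (zval_z0, zval_z1, zval_z2, zval_zf, zval_zf1, zval_zf2,
  zval_zf3, zval_zs, zval_zt, zval_zu, zval_z2t).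

(** The equations among the hypotheses let the precomputed tree and the real constants of the
    definitions replace their symbolic values. *)
Lemma induced_stage (N : nat) (al ga be a b : zphi) (st : zvec) (T U : tree nat)
    (ws : seq (seq nat)) (P : Defs.partition R) (act : action R) (i : direction)
    (L : plane * plane) (a' b' : R) :
  stage_check 5 N al ga be a b st T ws ->
  U = index_tree ws (return_tree 5 al ga be a b st T) ->
  L = lat (zval al) (zval ga) (zval be) -> zval a = a' -> zval b = b' ->
  (forall k x, act (unit_step i k) x = x + vval st *+ k) ->
  described (zval al) (zval ga) (zval be) P T ->
  [/\ induced_morphism i L P act a' b' = [seq word_along i w | w <- ws],
    size (induced_partition i L P act a' b') = size ws &
    described a' 0 b' (induced_partition i L P act a' b') U].
Proof.
move=> chk -> -> <- <- actE PT; have [rw d] := stage chk actE PT.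
by split=> //; rewrite ?/induced_morphism ?/induced_partition ?size_map rw.
Qed.

Lemma pairMn (v : plane) k : v *+ k = (v.1 * k%:R, v.2 * k%:R).
Proof.
elim: k => [|k IH]; first by rewrite !mulr0.
by rewrite mulrSr IH -natr1 !mulrDr !mulr1.
Qed.

Lemma part0E : part0 R = polygon_partition (lat phi 1 (phi + 3))
  [seq [seq [seq vval v | v <- vs] | vs <- ps] | ps <- polygons0].
Proof. by rewrite /part0 /polygons0 /= /vval /= !zvals. Qed.

Lemma partUE : partU R = polygon_partition (lat 1 0 1)
  [seq [seq [seq vval v | v <- vs] | vs <- ps] | ps <- polygonsU].
Proof. by rewrite /partU /polygonsU /= /vval /= !zvals. Qed.

Lemma described0 : described phi 1 (phi + 3) (part0 R) tree0.
Proof.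
have : polygon_check zf zf3 polygons0 tree0 by vm_compute.
by move/(@polygon_described R zf z1 zf3); rewrite !zvals -part0E.
Qed.

Lemma describedU : described 1 0 1 (partU R) treeU.
Proof.
have : polygon_check z1 z1 polygonsU treeU by vm_compute.
by move/(@polygon_described R z1 z0 z1); rewrite !zvals -partUE.
Qed.

Ltac step := by move=> k x; rewrite pairMn /vval /= !zvals; congr pair;
  rewrite -?pmulrn /=; ring.

Lemma stage0 : [/\ beta0 R = omega0123, size (part1 R) = 28%N &
  described phi 0 1 (part1 R) tree1].
Proof.
have eqU : tree1 = index_tree (words omega0123)
    (return_tree 5 zf z1 zf3 zf z1 (z0, z1) tree0).
  by vm_compute.
(* A grid with 14 subdivisions per side meets all 28 cells at regular points; coarser grids are
   enough for the later stages. *)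
have chk : stage_check 5 14 zf z1 zf3 zf z1 (z0, z1) tree0 (words omega0123).
  by vm_compute.
have := @induced_stage 14 zf z1 zf3 zf z1 (z0, z1) tree0 tree1 (words omega0123)
  (part0 R) (@Defs.rot0 R) E2 (Gamma0 R) phi 1 chk eqU.
rewrite !zvals => /(_ erefl erefl erefl); apply; first step.
exact: described0.
Qed.

Lemma stage2 : [/\ beta2 R = kappa, size (part3 R) = 20%N &
  described 1 0 1 (part3 R) tree3].
Proof.
have eqU : tree3 = index_tree (words kappa)
    (return_tree 5 zf z0 z1 z1 z1 (z1, z0) tree1).
  by vm_compute.
have chk : stage_check 5 10 zf z0 z1 z1 z1 (z1, z0) tree1 (words kappa).
  by vm_compute.
have := @induced_stage 10 zf z0 z1 z1 z1 (z1, z0) tree1 tree3 (words kappa)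
  (part2 R) (@Defs.rot2 R) E1 (rectangular phi 1) 1 1 chk eqU.
rewrite !zvals => /(_ erefl erefl erefl); apply; first step.
by have [] := stage0.
Qed.

Lemma stage3 : [/\ beta3 R = omega7, size (part4 R) = 20%N &
  described phi^-1 0 1 (part4 R) tree4].
Proof.
have eqU : tree4 = index_tree (words omega7)
    (return_tree 5 z1 z0 z1 zs z1 (zt, z0) tree3).
  by vm_compute.
have chk : stage_check 5 9 z1 z0 z1 zs z1 (zt, z0) tree3 (words omega7).
  by vm_compute.
have := @induced_stage 9 z1 z0 z1 zs z1 (zt, z0) tree3 tree4 (words omega7)
  (part3 R) (@Defs.rot3 R) E1 (rectangular 1 1) phi^-1 1 chk eqU.
rewrite !zvals => /(_ erefl erefl erefl); apply; first step.
by have [] := stage2.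
Qed.

Lemma stage4 : [/\ beta4 R = omega8, size (part5 R) = 22%N &
  described phi^-1 0 phi^-1 (part5 R) tree5].
Proof.
have eqU : tree5 = index_tree (words omega8)
    (return_tree 5 zs z0 z1 zs zs (z0, zt) tree4).
  by vm_compute.
have chk : stage_check 5 9 zs z0 z1 zs zs (z0, zt) tree4 (words omega8).
  by vm_compute.
have := @induced_stage 9 zs z0 z1 zs zs (z0, zt) tree4 tree5 (words omega8)
  (part4 R) (@Defs.rot4 R) E2 (rectangular phi^-1 1) phi^-1 phi^-1 chk eqU.
rewrite !zvals => /(_ erefl erefl erefl); apply; first step.
by have [] := stage3.
Qed.

Lemma described_h P T : wf (tsubst (zs, zs) (zopp zs, zopp zs) T) ->
  described phi^-1 0 phi^-1 P T ->
  described 1 0 1 (map_partition (@h R) P) (tsubst (zs, zs) (zopp zs, zopp zs) T).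
Proof.
have f0 := phi_neq0.
move=> wfT; apply: described_map => //=;
  rewrite ?zvalN ?zvals ?oppr_eq0 ?invr_eq0 //.
- by move=> [y1 y2]; rewrite /h /=; congr pair; field.
- by move=> [x1 x2]; rewrite /h /=; congr pair; field.
- by exists 1, 1; rewrite /vval /= !zvals !mulr0 !mul1r addr0 add0r.
- move=> v [m [n ->]]; exists (- m), (- n); rewrite /= !rmorphN /=.
  by congr pair; ring.
- move=> y [/andP[h1 h2] /andP[h3 h4]].
  have s0 : 0 < phi^-1 by rewrite invr_gt0 (lt_trans ltr01) // phi_gt1.
  have k1 := mulr_gt0 s0 h1; have k3 := mulr_gt0 s0 h3.
  have k2 : 0 < phi^-1 * (1 - y.1) by rewrite mulr_gt0 // subr_gt0.
  have k4 : 0 < phi^-1 * (1 - y.2) by rewrite mulr_gt0 // subr_gt0.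
  by rewrite /diag /vval /box /= !zvalN !zvals; split; lra.
Qed.

Lemma described_g P T : wf (tsubst (zs, z0) (zopp zs, z1) T) ->
  described phi^-1 0 1 P T ->
  described 1 0 1 (map_partition (@g R) P) (tsubst (zs, z0) (zopp zs, z1) T).
Proof.
have f0 := phi_neq0.
move=> wfT; apply: described_map => //=;
  rewrite ?zvalN ?zvals ?oppr_eq0 ?invr_eq0 ?oner_neq0 //.
- by move=> [y1 y2]; rewrite /g /=; congr pair; field.
- by move=> [x1 x2]; rewrite /g /=; congr pair; field.
- by exists 1, 0; rewrite /vval /= !zvals !mulr0 !mul1r !mul0r !addr0.
- move=> v [m [n ->]]; exists (- m), n; rewrite /= !rmorphN /=.
  by congr pair; ring.
- move=> y [/andP[h1 h2] /andP[h3 h4]].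
  have s0 : 0 < phi^-1 by rewrite invr_gt0 (lt_trans ltr01) // phi_gt1.
  have k1 := mulr_gt0 s0 h1.
  have k2 : 0 < phi^-1 * (1 - y.1) by rewrite mulr_gt0 // subr_gt0.
  by rewrite /diag /vval /box /= !zvalN !zvals; split; lra.
Qed.

Lemma stage5 : [/\ beta5 R = omega9, size (part6 R) = 18%N &
  described phi^-1 0 1 (part6 R) tree6].
Proof.
have eqU : tree6 = index_tree (words omega9)
    (return_tree 5 z1 z0 z1 zs z1 (zt, z0) tree5').
  by vm_compute.
have chk : stage_check 5 9 z1 z0 z1 zs z1 (zt, z0) tree5' (words omega9).
  by vm_compute.
have := @induced_stage 9 z1 z0 z1 zs z1 (zt, z0) tree5' tree6 (words omega9)
  (part5' R) (@Defs.rot3 R) E1 (rectangular 1 1) phi^-1 1 chk eqU.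
rewrite !zvals => /(_ erefl erefl erefl); apply; first step.
have [w _ _] := wf_rescaled; have [_ _ d] := stage4.
exact: (described_h w d).
Qed.

Lemma stage6 : [/\ beta6 R = omega10, size (part7 R) = 21%N &
  described phi^-1 0 phi^-1 (part7 R) tree7].
Proof.
have eqU : tree7 = index_tree (words omega10)
    (return_tree 5 zs z0 z1 zs zs (z0, zt) tree6).
  by vm_compute.
have chk : stage_check 5 10 zs z0 z1 zs zs (z0, zt) tree6 (words omega10).
  by vm_compute.
have := @induced_stage 10 zs z0 z1 zs zs (z0, zt) tree6 tree7 (words omega10)
  (part6 R) (@Defs.rot4 R) E2 (rectangular phi^-1 1) phi^-1 phi^-1 chk eqU.
rewrite !zvals => /(_ erefl erefl erefl); apply; first step.
by have [] := stage5.
Qed.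

Lemma stage7 : [/\ beta7 R = omega11, size (part8 R) = 19%N &
  described phi^-1 0 1 (part8 R) tree8].
Proof.
have eqU : tree8 = index_tree (words omega11)
    (return_tree 5 z1 z0 z1 zs z1 (zt, z0) tree7').
  by vm_compute.
have chk : stage_check 5 9 z1 z0 z1 zs z1 (zt, z0) tree7' (words omega11).
  by vm_compute.
have := @induced_stage 9 z1 z0 z1 zs z1 (zt, z0) tree7' tree8 (words omega11)
  (part7' R) (@Defs.rot3 R) E1 (rectangular 1 1) phi^-1 1 chk eqU.
rewrite !zvals => /(_ erefl erefl erefl); apply; first step.
have [_ w _] := wf_rescaled; have [_ _ d] := stage6.
exact: (described_h w d).
Qed.

Lemma stage8 : [/\ beta8 R = [seq col_word w | w <- words8],
  size (part9 R) = 21%N &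
  described phi^-1 0 phi^-1 (part9 R) tree9].
Proof.
have eqU : tree9 = index_tree words8
    (return_tree 5 zs z0 z1 zs zs (z0, zt) tree8).
  by vm_compute.
have chk : stage_check 5 10 zs z0 z1 zs zs (z0, zt) tree8 words8.
  by vm_compute.
have := @induced_stage 10 zs z0 z1 zs zs (z0, zt) tree8 tree9 words8
  (part8 R) (@Defs.rot4 R) E2 (rectangular phi^-1 1) phi^-1 phi^-1 chk eqU.
rewrite !zvals => /(_ erefl erefl erefl); apply; first step.
by have [] := stage7.
Qed.

Lemma stage9 : [/\ beta9 R = [seq row_word w | w <- words9],
  size (part10 R) = 19%N &
  described phi^-1 0 1 (part10 R) tree10].
Proof.
have eqU : tree10 = index_tree words9
    (return_tree 5 z1 z0 z1 zs z1 (zt, z0) tree9').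
  by vm_compute.
have chk : stage_check 5 9 z1 z0 z1 zs z1 (zt, z0) tree9' words9.
  by vm_compute.
have := @induced_stage 9 z1 z0 z1 zs z1 (zt, z0) tree9' tree10 words9
  (part9' R) (@Defs.rot3 R) E1 (rectangular 1 1) phi^-1 1 chk eqU.
rewrite !zvals => /(_ erefl erefl erefl); apply; first step.
have [_ _ w] := wf_rescaled; have [_ _ d] := stage8.
exact: (described_h w d).
Qed.

Lemma unique_tau : unique (@is_tau R) tau.
Proof.
have [_ s8 d8] := stage7; have [_ s10 d10] := stage9.
rewrite -zval_zs -zval_z1 in d8 d10.
have bt := tau_bijection.
rewrite -[X in index_bijection X]s8 -[X in index_bijection _ X]s10 in bt.
have et a : (a < size (part8 R))%N -> eq_mod_segments (rectangular phi^-1 1)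
    (atom (part10 R) (nth 0%N tau a)) (atom (part8 R) a).
  rewrite -zval_zs -zval_z1 => aP.
  exact: (@described_compare R zs z1 isT isT _ _ _ _ _ d8 d10 compare_tau
    (fun l lP => index_bijection_lt bt lP) (index_bijection_inj bt) _ aP).
split=> [|t' [bt' et']]; first by split.
have smp : all (sampled zs z1 9 tree10) (iota 0 (size (part10 R))).
  by rewrite s10; exact: sampled10.
rewrite -zval_zs -zval_z1 in et et'.
exact: (@bijection_unique R zs z1 isT isT _ _ _ _ _ _ _ d10 smp bt bt' et et').
Qed.

Lemma unique_rho : unique (@is_zeta R) rho.
Proof.
have [_ s8 d8] := stage7.
have dg := described_g wf_tree8' d8; have dU := describedU.
rewrite -zval_z1 in dg dU.
have sg : size (map_partition (@g R) (part8 R)) = size (part8 R).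
  by rewrite size_map.
have sU : size (partU R) = 19%N by rewrite size_map.
have atomE a : (a < size (part8 R))%N ->
    atom (map_partition (@g R) (part8 R)) a = @g R @` atom (part8 R) a.
  by move=> aP; rewrite /atom (nth_map set0).
have bt := rho_bijection; rewrite -[X in index_bijection _ X]s8 in bt.
have et a : (a < 19)%N -> eq_mod_segments (rectangular 1 1)
    (@g R @` atom (part8 R) (nth 0%N rho a)) (atom (partU R) a).
  move=> aP; rewrite -atomE; last exact: index_bijection_lt bt aP.
  rewrite -sg -sU in bt; rewrite -sU in aP; rewrite -zval_z1.
  exact: (@described_compare R z1 z1 isT isT _ _ _ _ _ dU dg compare_rho
    (fun l lP => index_bijection_lt bt lP) (index_bijection_inj bt) _ aP).
split=> [|t' [bt' et']]; first by split.
have smp : all (sampled z1 z1 9 tree8')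
    (iota 0 (size (map_partition (@g R) (part8 R)))).
  by rewrite sg s8; exact: sampled8'.
have cut (t : seq nat) : index_bijection 19 (size (part8 R)) t ->
    (forall a, (a < 19)%N -> eq_mod_segments (rectangular 1 1)
      (@g R @` atom (part8 R) (nth 0%N t a)) (atom (partU R) a)) ->
    forall a, (a < 19)%N -> eq_mod_segments (rectangular (zval z1) (zval z1))
      (atom (map_partition (@g R) (part8 R)) (nth 0%N t a)) (atom (partU R) a).
  move=> b e a aP; rewrite zval_z1 atomE; last exact: index_bijection_lt b aP.
  exact: e.
have e1 := cut _ bt et; have e2 := cut _ bt' et'.
rewrite -[X in index_bijection _ X]sg in bt bt'.
exact: (@bijection_unique R z1 z1 isT isT _ _ _ _ _ _ _ dg smp bt bt' e1 e2).
Qed.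

End Instances.

Theorem theorem1p3 (R : realType) :
  beta0 R = omega0123 /\
  ([seq beta1 (word_pattern w) | w <- beta2 R]
     = [seq theta_M (word_pattern w) | w <- kappa] /\
   forall x y : configuration,
     (exists2 z, configuration_image (beta2 R) x z & y = beta1 z) <->
     (exists2 z, configuration_image kappa x z & y = theta_M z)) /\
  beta3 R = omega7 /\
  beta4 R = omega8 /\
  beta5 R = omega9 /\
  beta6 R = omega10 /\
  beta7 R = omega11 /\
  exists tau zeta : seq nat,
    [/\ unique (@is_tau R) tau,
        unique (@is_zeta R) zeta,
        zeta = rho &
        exists2 f : morphism,
          obind (compose (beta8 R)) (compose (beta9 R) (recoding tau)) = Some f
          & obind (compose (recoding rho))
              (compose omegaU (recoding (inverse_bijection rho))) = Some f].
Proof.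
have [-> _ _] := stage0 R; have [-> _ _] := stage2 R.
have [-> _ _] := stage3 R; have [-> _ _] := stage4 R.
have [-> _ _] := stage5 R; have [-> _ _] := stage6 R.
have [-> _ _] := stage7 R; have [-> _ _] := stage8 R.
have [-> _ _] := stage9 R.
(* [beta1] is [theta_M] by definition, so once [beta2] is [kappa] the two sides of the second
   statement are convertible. *)
do 7!split=> //; exists tau, rho; split => //.
- exact: unique_tau.
- exact: unique_rho.
- by eexists; vm_compute.
Qed.
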